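(* For each $\varepsilon>0$, as $k\to\infty$, \[\Bigl\lvert\bigl\{t\in\{1,\ldots,2^k-2\}:P_{t,k}\notin(1/2-\varepsilon,\,1/2)\bigr\}\Bigr\rvert=O\!\left(\frac{2^k}{k}\right).\] In particular, \[\lim_{k\to\infty}\frac1{2^k}\Bigl\lvert\bigl\{t\in\{1,\ldots,2^k-2\}:1/2-\varepsilon<P_{t,k}<1/2\bigr\}\Bigr\rvert=1.\]
   Context: For a nonnegative integer $n$, $w(n)$ denotes the number of $1$s in the binary expansion of $n$ (the binary sum of digits / Hamming weight). For integers $k\ge1$ and $t\in\{1,\ldots,2^k-2\}$ define \[S_{t,k}=\Bigl\{(a,b)\in\{0,\ldots,2^k-2\}^2:\ a+b\equiv t \pmod{2^k-1},\ w(a)+w(b)<k\Bigr\},\qquad P_{t,k}=\frac{\lvert S_{t,k}\rvert}{2^k}.\] *)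

(* Defs.v *)
From HB Require Import structures.
From mathcomp Require Import all_boot all_order all_algebra.
From mathcomp Require Import all_classical all_reals all_analysis.

Set Implicit Arguments.
Unset Strict Implicit.
Unset Printing Implicit Defensive.

Import Order.TTheory GRing.Theory Num.Theory.
Import numFieldNormedType.Exports.

Local Open Scope ring_scope.

(* Number of 1s in the binary expansion of n: for n > 0 the binary digits of n
   are the parities of n %/ 2 ^ i for 0 <= i <= trunc_log 2 n. For n = 0,
   trunc_log 2 0 = 0 and the only digit is 0. *)
Definition binary_weight (n : nat) : nat :=
  (\sum_(0 <= i < (trunc_log 2 n).+1) odd (n %/ 2 ^ i))%N.

(* {0, ..., 2^k - 2}. For k = 0 this type is empty; only k >= 1 is meaningful
   below. *)
Definition residue (k : nat) := 'I_(2 ^ k - 1).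

Definition S_set (t k : nat) : {set residue k * residue k} :=
  [set ab : residue k * residue k | (ab.1 + ab.2 == t %[mod 2 ^ k - 1])%N
      & (binary_weight ab.1 + binary_weight ab.2 < k)%N].

Definition P_ratio (R : realType) (t k : nat) : R :=
  #|S_set t k|%:R / 2 ^+ k.

(* t ranges over {1, ..., 2^k - 2}: the residue 0 belongs neither to typical_set
   nor to exceptional_set. *)
Definition typical_set (R : realType) (eps : R) (k : nat) : {set residue k} :=
  [set t : residue k | (0 < t)%N & P_ratio R t k \in `](1 / 2 - eps), (1 / 2)[].

Definition exceptional_set (R : realType) (eps : R) (k : nat) :
    {set residue k} :=
  [set t : residue k
    | (0 < t)%N & P_ratio R t k \notin `](1 / 2 - eps), (1 / 2)[].

(* Main.v *)
Require Import Defs.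
From HB Require Import structures.
From mathcomp Require Import all_boot all_order all_algebra.
From mathcomp Require Import all_classical all_reals all_analysis.
From mathcomp Require Import ring lra zify.
Set Implicit Arguments.
Unset Strict Implicit.
Unset Printing Implicit Defensive.
Import Order.TTheory GRing.Theory Num.Theory.
Import numFieldNormedType.Exports.
Local Open Scope classical_set_scope.
Local Open Scope ring_scope.

(* For a k-bit t let (a, b) range over the pairs of k-bit numbers with
   a + b + c = t + c 2 ^ k for a cyclic carry c in {0, 1}, and let
   D = w(a) + w(b) - k. There are 2 ^ k + 1 such pairs (one pair is the surplus
   of the double representation of 0), and #|S_set t k| counts those with D < 0,
   so that 2 P = 1 + 2 ^- k - P(D = 0) - (P(D > 0) - P(D < 0)).
   Averaged over t, P(D = 0) is of exact order k ^ (-1/2), and it suffices that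
   its variance and the second moment of the skewness P(D > 0) - P(D < 0) are
   O(1 / k ^ 2): Chebyshev's inequality then leaves O(2 ^ k / k) exceptional t.
   Both quantities are Fourier sums of the characteristic function of D at
   frequencies 2 y, which obeys a linear recurrence on pairs (u, v) of complex
   numbers, one for each incoming carry: a low-order digit 0 (resp. 1) of t
   replaces u (resp. v) by (exp(-2iy) u + exp(2iy) v) / 2. For p = (u + v) / 2,
   d = (v - u) / 2 and al = sin(y) ^ 2, a random digit yields a closed linear
   system for the second moments of p and d. Starting from p = 1 and d = 0,
   E p = (1 - al) ^ k is real, the variance of p is O(k al ^ 2 (1 - al) ^ k), and
   the second moment of the imaginary part of p is only O(k al ^ 3 (1 - al) ^ k);
   the extra factor al pays for the singularity at y = 0 of the Fourier kernel of
   the sign function. *)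

(** * The linear system for the second moments *)

(** Here [x] is al, and [a], [b], [e] stand for the means of |p|^2, |d|^2 and be Im(p conj d), where
    be = sin y cos y. Absorbing be into [e] leaves only be^2 = x (1 - x) in the coefficients. *)
Record moment_recurrence (R : realFieldType) (x : R) (a b e : nat -> R) : Prop := {
  moment_a_ge0 : forall n, 0 <= a n;
  moment_b_ge0 : forall n, 0 <= b n;
  moment_aS : forall n, a n.+1 =
    (1 - x) ^+ 2 * a n + 2 * (1 - x) * e n + (x * (1 - x) + 1 / 4) * b n;
  moment_bS : forall n, b n.+1 =
    (1 / 4 + x * (1 - x)) * b n + x ^+ 2 * a n - 2 * x * e n;
  moment_eS : forall n, e n.+1 = (1 / 2 - x) * e n + x * (1 - x) * b n
}.

Lemma e_ge0 (R : realFieldType) (x : R) (a b e : nat -> R) n :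
  moment_recurrence x a b e -> 0 <= x -> x <= 1 / 10 -> e 0 = 0 ->
  0 <= e n.
Proof.
move=> H x_ge0 x_le e0; have [a_ge0 b_ge0 aS bS eS] := H.
elim: n => [|n IH]; first by rewrite e0.
rewrite eS; apply: addr_ge0; apply: mulr_ge0 => //; first by lra.
by apply: mulr_ge0 => //; lra.
Qed.

(** The form a + 8 b + 8 e contracts by 1 - x in each step: [ha], [hb] and [he] compare the
    coefficients of a, b and e. The first comparison needs x <= 1/9, hence the threshold 1/10. *)
Lemma weighted_moments_le (R : realFieldType) (x : R) (a b e : nat -> R) n :
  moment_recurrence x a b e -> 0 <= x -> x <= 1 / 10 -> e 0 = 0 ->
  a n + 8 * b n + 8 * e n <= (a 0 + 8 * b 0) * (1 - x) ^+ n.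
Proof.
move=> H x_ge0 x_le e0; have [a_ge0 b_ge0 aS bS eS] := H.
have e_ge0 m := e_ge0 m H x_ge0 x_le e0.
elim: n => [|n IH]; first by rewrite e0 expr0; lra.
have step : a n.+1 + 8 * b n.+1 + 8 * e n.+1 <=
    (1 - x) * (a n + 8 * b n + 8 * e n).
  rewrite aS bS eS.
  have ha : (1 - x) ^+ 2 + 8 * x ^+ 2 <= 1 - x by nra.
  have hb : 17 * (x * (1 - x)) + 9 / 4 <= 8 * (1 - x) by nra.
  have he : 2 * (1 - x) - 16 * x + 8 * (1 / 2 - x) <= 8 * (1 - x) by lra.
  have := ler_wpM2r (a_ge0 n) ha; have := ler_wpM2r (b_ge0 n) hb.
  have := ler_wpM2r (e_ge0 n) he.
  by lra.
apply: (le_trans step); rewrite exprS mulrCA ler_wpM2l //; lra.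
Qed.

(** As e >= 0, a step at least halves b and feeds in x^2 a = O(x^2 (1 - x)^n). The feed decays more
    slowly than 2^-n and so dominates; the constant 3 works because 3 (1 - x) >= 3/2 + 1. *)
Lemma b_le_small (R : realFieldType) (x : R) (a b e : nat -> R) n :
  moment_recurrence x a b e -> 0 <= x -> x <= 1 / 10 -> e 0 = 0 ->
  b n <= b 0 * (1 / 2) ^+ n
  + 3 * (a 0 + 8 * b 0) * x ^+ 2 * (1 - x) ^+ n.
Proof.
move=> H x_ge0 x_le e0; have [a_ge0 b_ge0 aS bS eS] := H.
have e_ge0 m := e_ge0 m H x_ge0 x_le e0.
have weighted_moments_le m := weighted_moments_le m H x_ge0 x_le e0.
have l0 : 0 <= a 0 + 8 * b 0 by have := a_ge0 0; have := b_ge0 0; lra.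
have x2 : 0 <= x ^+ 2 by exact: sqr_ge0.
elim: n => [|n IH]; first by rewrite !expr0 mulr1; nra.
have hm : 0 <= (1 - x) ^+ n by rewrite exprn_ge0 //; lra.
have h1 : b n.+1 <= 1 / 2 * b n + x ^+ 2 * a n.
  rewrite bS.
  have h : 1 / 4 + x * (1 - x) <= 1 / 2 by nra.
  have := ler_wpM2r (b_ge0 n) h; have := mulr_ge0 x_ge0 (e_ge0 n); lra.
have h2 : a n <= (a 0 + 8 * b 0) * (1 - x) ^+ n.
  have := weighted_moments_le n; have := b_ge0 n; have := e_ge0 n; lra.
have h3 := ler_wpM2l x2 h2.
have h4 : 0 <= (a 0 + 8 * b 0) * x ^+ 2 * (1 - x) ^+ n.
  by rewrite !mulr_ge0.
have h5 : 0 <= (1 / 10 - x) * ((a 0 + 8 * b 0) * x ^+ 2 * (1 - x) ^+ n).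
  by rewrite mulr_ge0 // subr_ge0.
rewrite !exprS.
lra.
Qed.

(** The same mechanism one order higher: e is at least halved and is fed by x b = O(x^3 (1 -
    x)^n). *)
Lemma e_le_small (R : realFieldType) (x : R) (a b e : nat -> R) n :
  moment_recurrence x a b e -> 0 <= x -> x <= 1 / 10 -> e 0 = 0 ->
  a 0 = 1 -> b 0 = 0 ->
  e n <= 9 * x ^+ 3 * (1 - x) ^+ n.
Proof.
move=> H x_ge0 x_le e0 a0 b0; have [a_ge0 b_ge0 aS bS eS] := H.
have e_ge0 m := e_ge0 m H x_ge0 x_le e0.
have pow_ge0 m : 0 <= (1 - x) ^+ m by rewrite exprn_ge0 //; lra.
have b_le m : b m <= 3 * x ^+ 2 * (1 - x) ^+ m.
  by have := b_le_small m H x_ge0 x_le e0; rewrite a0 b0; lra.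
elim: n => [|n IH]; first by rewrite e0 expr0 mulr1 mulr_ge0 // exprn_ge0.
have h1 : e n.+1 <= 1 / 2 * e n + x * b n.
  rewrite eS.
  have := mulr_ge0 x_ge0 (e_ge0 n); have := mulr_ge0 (sqr_ge0 x) (b_ge0 n).
  by lra.
have h2 := ler_wpM2l x_ge0 (b_le n).
have h4 : 0 <= x ^+ 3 * (1 - x) ^+ n by rewrite mulr_ge0 // exprn_ge0.
have h5 : 0 <= (1 / 10 - x) * (x ^+ 3 * (1 - x) ^+ n).
  by rewrite mulr_ge0 // subr_ge0.
rewrite [(1 - x) ^+ n.+1]exprS; lra.
Qed.

(** The excess a - (1 - x)^(2 n) contracts by (1 - x)^2 and is fed by b and e, both O(x^2 (1 -
    x)^n). The feeds of n steps accumulate to the factor n. *)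
Lemma variance_le_small (R : realFieldType) (x : R) (a b e : nat -> R) n :
  moment_recurrence x a b e -> 0 <= x -> x <= 1 / 10 -> e 0 = 0 ->
  a 0 = 1 -> b 0 = 0 ->
  a n - (1 - x) ^+ (2 * n) <=
  5 * n%:R * x ^+ 2 * (1 - x) ^+ n.
Proof.
move=> H x_ge0 x_le e0 a0 b0; have [a_ge0 b_ge0 aS bS eS] := H.
have e_ge0 m := e_ge0 m H x_ge0 x_le e0.
have pow_ge0 m : 0 <= (1 - x) ^+ m by rewrite exprn_ge0 //; lra.
have b_le m : b m <= 3 * x ^+ 2 * (1 - x) ^+ m.
  by have := b_le_small m H x_ge0 x_le e0; rewrite a0 b0; lra.
have e_le_small m := e_le_small m H x_ge0 x_le e0 a0 b0.
suff: 0 <= a n - (1 - x) ^+ (2 * n) <= 5 * n%:R * x ^+ 2 * (1 - x) ^+ n.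
  by case/andP.
elim: n => [|n /andP[IH0 IH]]; first by rewrite a0; lra.
have -> : a n.+1 - (1 - x) ^+ (2 * n.+1) = (1 - x) ^+ 2 * (a n - (1 - x) ^+ (2 * n))
   + (2 * (1 - x) * e n + (x * (1 - x) + 1 / 4) * b n).
  by rewrite aS mulnS exprD; ring.
have hx : 0 <= 1 - x by lra.
apply/andP; split.
  have k1 := mulr_ge0 (sqr_ge0 (1 - x)) IH0.
  have k2 := mulr_ge0 hx (e_ge0 n).
  have k3 : 0 <= x * (1 - x) + 1 / 4 by nra.
  have := mulr_ge0 k3 (b_ge0 n); lra.
have hq : x * (1 - x) + 1 / 4 <= 2 / 5 by nra.
have h1 := ler_wpM2r (b_ge0 n) hq.
have h2 : (1 - x) * e n <= e n by have := mulr_ge0 x_ge0 (e_ge0 n); lra.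
have h3 := e_le_small n; have h4 := b_le n.
have h5 : 0 <= (1 / 10 - x) * (x ^+ 2 * (1 - x) ^+ n).
  by rewrite mulr_ge0 ?subr_ge0 // mulr_ge0 ?sqr_ge0.
have h6 : (1 - x) ^+ 2 * (a n - (1 - x) ^+ (2 * n)) <=
   (1 - x) * (5 * n%:R * x ^+ 2 * (1 - x) ^+ n).
  rewrite expr2 -mulrA ler_wpM2l //; apply: le_trans IH.
  by rewrite ler_piMl //; lra.
have h7 := mulr_ge0 (sqr_ge0 x) (pow_ge0 n).
rewrite [(1 - x) ^+ n.+1]exprS -(natr1 n).
lra.
Qed.

(** [I] and [K] are the second moments of the imaginary parts of p and d. In I + K the terms in K
    are absorbed by the contraction and b enters only with a factor x, so each feed is O(x^3 (1 -
    x)^n), one power of x better than for the variance. *)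
Lemma imaginary_moment_le_small (R : realFieldType) (x : R) (a b e I K : nat -> R) n :
  moment_recurrence x a b e -> 0 <= x -> x <= 1 / 10 -> e 0 = 0 ->
  a 0 = 1 -> b 0 = 0 ->
  (forall m, 0 <= I m) -> (forall m, 0 <= K m) -> I 0 = 0 -> K 0 = 0 ->
  (forall m, I m.+1 = (1 - x) ^+ 2 * I m + (1 - x) * e m
     + K m / 4 + x * (1 - x) * (b m - K m)) ->
  (forall m, K m.+1 = K m / 4 + x * (1 - x) * (b m - K m)
     + x ^+ 2 * I m - x * e m) ->
  I n <= 17 * n%:R * x ^+ 3 * (1 - x) ^+ n.
Proof.
move=> H x_ge0 x_le e0 a0 b0 I_ge0 K_ge0 I0 K0 IS KS; have [a_ge0 b_ge0 aS bS eS] := H.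
have e_ge0 m := e_ge0 m H x_ge0 x_le e0.
have pow_ge0 m : 0 <= (1 - x) ^+ m by rewrite exprn_ge0 //; lra.
have b_le m : b m <= 3 * x ^+ 2 * (1 - x) ^+ m.
  by have := b_le_small m H x_ge0 x_le e0; rewrite a0 b0; lra.
have e_le_small m := e_le_small m H x_ge0 x_le e0 a0 b0.
suff: I n + K n <= 17 * n%:R * x ^+ 3 * (1 - x) ^+ n.
  by have := K_ge0 n; lra.
elim: n => [|n IH]; first by rewrite I0 K0; lra.
have h3 := e_le_small n; have h4 := ler_wpM2l x_ge0 (b_le n).
have hx : 0 <= 1 - x by lra.
have hI : (1 - x) ^+ 2 + x ^+ 2 <= 1 - x by nra.
have h1 := ler_wpM2r (I_ge0 n) hI.
have h2 := mulr_ge0 (mulr_ge0 x_ge0 hx) (K_ge0 n).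
have h5 : 0 <= (1 / 10 - x) * (x ^+ 3 * (1 - x) ^+ n).
  by rewrite mulr_ge0 ?subr_ge0 // mulr_ge0 // exprn_ge0.
have h6 : (1 - x) * (I n + K n) <= (1 - x) * (17 * n%:R * x ^+ 3 * (1 - x) ^+ n).
  by rewrite ler_wpM2l.
have h7 : 0 <= (1 / 10 - x) * K n by rewrite mulr_ge0 ?subr_ge0.
have h8 := mulr_ge0 x_ge0 (e_ge0 n).
have h9 := mulr_ge0 (sqr_ge0 x) (b_ge0 n).
have h10 := K_ge0 n.
have h11 : 0 <= x ^+ 3 * (1 - x) ^+ n by rewrite mulr_ge0 // exprn_ge0.
rewrite IS KS [(1 - x) ^+ n.+1]exprS -(natr1 n).
lra.
Qed.

Lemma moments_le_mid (R : realFieldType) (x : R) (a b e : nat -> R) n :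
  moment_recurrence x a b e -> 0 <= x -> x <= 1 ->
  (forall m, `|e m| <= (a m + b m) / 4) ->
  1 / 10 <= x -> x <= 9 / 20 ->
  a n + b n <= 9 * (a 0 + b 0) * (91 / 100) ^+ n.
Proof.
move=> H x_ge0 x_le1 e_le; have [a_ge0 b_ge0 aS bS eS] := H.
move=> x_ge x_le.
have hx0 : 0 < x by lra.
(* With this weight the contributions of [e] to a + c b cancel. The coefficient of b prevents larger
   x: at x = 1/2 it no longer contracts. *)
pose c := (1 - x) / x.
have cx : c * x = 1 - x by rewrite /c divfK // gt_eqF.
have c1 : 1 <= c by rewrite /c ler_pdivlMr // ; lra.
have c9 : c <= 9 by rewrite /c ler_pdivrMr //; lra.
suff h : a n + c * b n <= (a 0 + c * b 0) * (91 / 100) ^+ n.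
  have hp : 0 <= (91 / 100 : R) ^+ n by rewrite exprn_ge0 //; lra.
  have h1 := ler_wpM2r (b_ge0 n) c1.
  have h2 := ler_wpM2r (b_ge0 0) c9.
  have h3 : a 0 + c * b 0 <= 9 * (a 0 + b 0) by have := a_ge0 0; lra.
  have := ler_wpM2r hp h3; lra.
elim: n => [|n IH]; first by rewrite expr0; lra.
rewrite exprS mulrCA; apply: le_trans (ler_wpM2l _ IH); last by lra.
have -> : a n.+1 + c * b n.+1 = (1 - x) ^+ 2 * a n + 2 * (1 - x) * e n
   + (x * (1 - x) + 1 / 4) * b n + (c / 4 * b n + c * x * (1 - x) * b n
   + c * x * x * a n - 2 * (c * x) * e n).
  by rewrite aS bS; ring.
rewrite cx.
have hb : x * (1 - x) + 1 / 4 + c / 4 + (1 - x) * (1 - x) <= 91 / 100 * c.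
  rewrite -(ler_pM2r hx0).
  have -> : (x * (1 - x) + 1 / 4 + c / 4 + (1 - x) * (1 - x)) * x =
    x * (x * (1 - x) + 1 / 4 + (1 - x) * (1 - x)) + (c * x) / 4 by ring.
  by rewrite cx; nra.
have := ler_wpM2r (b_ge0 n) hb.
have : 0 <= (x - 1 / 10) * a n by rewrite mulr_ge0 // subr_ge0.
have := a_ge0 n.
lra.
Qed.

(** For larger x the contracting form is a + c b - r e. The bounds |e| <= (a + b) / 4 and r <= 7/5
    keep it comparable with a + b. *)
Lemma moments_le_weighted (R : realFieldType) (x : R) (a b e : nat -> R) c n :
  moment_recurrence x a b e -> 0 <= x -> x <= 1 ->
  (forall m, `|e m| <= (a m + b m) / 4) ->
  9 / 20 <= x ->
  9 / 10 <= c -> c <= 13 / 10 -> 1 - x <= c * x ->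
  (1 - x) ^+ 2 + c * x ^+ 2 <= 91 / 100 ->
  (x * (1 - x) + 1 / 4) * (1 + c) <= 91 / 100 * c ->
  2 * (c * x - (1 - x)) <= 14 / 10 * (41 / 100 + x) ->
  a n + b n <= 18 * (a 0 + b 0) * (91 / 100) ^+ n.
Proof.
move=> H x_ge0 x_le1 e_le; have [a_ge0 b_ge0 aS bS eS] := H.
move=> x_ge c_ge c_le hr hA hB hR.
have hs : 0 < 41 / 100 + x by lra.
(* This [r] makes the coefficient of e after a step exactly - 91/100 r. Since e is itself multiplied
   by 1/2 - x, the denominator is 91/100 - 1/2 + x. *)
pose r := 2 * (c * x - (1 - x)) / (41 / 100 + x).
have rs : r * (41 / 100 + x) = 2 * (c * x - (1 - x)).
  by rewrite /r divfK // gt_eqF.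
have r0 : 0 <= r by rewrite /r divr_ge0 ?mulr_ge0 //; lra.
have r14 : r <= 14 / 10 by rewrite /r ler_pdivrMr.
have eb m : r * `|e m| <= 7 / 20 * (a m + b m).
  have := ler_pM r0 (normr_ge0 _) r14 (e_le m); lra.
have el m : - `|e m| <= e m <= `|e m| by rewrite -ler_norml.
suff h : a n + c * b n - r * e n <= (a 0 + c * b 0 - r * e 0) * (91 / 100) ^+ n.
  have hp : 0 <= (91 / 100 : R) ^+ n by rewrite exprn_ge0 //; lra.
  have /andP[_ e1] := el n; have /andP[e2 _] := el 0.
  have := ler_wpM2l r0 e1; have := ler_wpM2l r0 e2.
  have := eb n; have := eb 0; have := a_ge0 0; have := b_ge0 0.
  have := a_ge0 n; have := b_ge0 n.
  have := ler_wpM2r (b_ge0 n) c_ge.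
  have := ler_wpM2r (b_ge0 0) c_le.
  move=> k1 k2 k3 k4 k5 k6 k7 k8 k9 k10.
  have h3 : a 0 + c * b 0 - r * e 0 <= 2 * (a 0 + b 0) by lra.
  have h4 := ler_wpM2r hp h3.
  have h5 : 0 <= (a 0 + b 0) * (91 / 100) ^+ n by rewrite mulr_ge0 // addr_ge0.
  lra.
elim: n => [|n IH]; first by rewrite expr0; lra.
rewrite exprS mulrCA; apply: le_trans (ler_wpM2l _ IH); last by lra.
have -> : a n.+1 + c * b n.+1 - r * e n.+1 = ((1 - x) ^+ 2 + c * x ^+ 2) * a n
   + (x * (1 - x) + 1 / 4) * (1 + c) * b n - r * (x * (1 - x) * b n)
   + (2 * (1 - x) - 2 * (c * x) + r * (41 / 100 + x)) * e n - 91 / 100 * (r * e n).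
  by rewrite aS bS eS; field.
rewrite rs.
have := ler_wpM2r (a_ge0 n) hA.
have := ler_wpM2r (b_ge0 n) hB.
have hx : 0 <= 1 - x by lra.
have : 0 <= r * (x * (1 - x) * b n) by apply: mulr_ge0 => //; rewrite !mulr_ge0.
lra.
Qed.

Lemma moments_le_large (R : realFieldType) (x : R) (a b e : nat -> R) n :
  moment_recurrence x a b e -> 0 <= x -> x <= 1 ->
  (forall m, `|e m| <= (a m + b m) / 4) ->
  1 / 10 <= x ->
  a n + b n <= 18 * (a 0 + b 0) * (91 / 100) ^+ n.
Proof.
move=> H x_ge0 x_le1 e_le; have [a_ge0 b_ge0 aS bS eS] := H.
move=> x_ge.
have [x1|x1] := lerP x (9 / 20).
  have := moments_le_mid n H x_ge0 x_le1 e_le x_ge x1.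
  have : 0 <= (a 0 + b 0) * (91 / 100) ^+ n.
    by rewrite mulr_ge0 ?addr_ge0 // exprn_ge0 //; lra.
  lra.
(* Near x = 1 the coefficient of [a] needs c x^2 below 91/100, while near 9/20 the condition 1 - x
   <= c x needs c above 1; hence two weights. *)
have [x2|x2] := lerP x (4 / 5).
  have sq := sqr_ge0 (x - 1 / 2).
  have prod : 0 <= (x - 9 / 20) * (4 / 5 - x) by apply: mulr_ge0; lra.
  apply: (@moments_le_weighted _ x a b e (13 / 10)) => //; lra.
have prod : 0 <= (x - 4 / 5) * (1 - x) by apply: mulr_ge0; lra.
have prod' : 0 <= (x - 4 / 5) * (x - 1 / 5) by apply: mulr_ge0; lra.
apply: (@moments_le_weighted _ x a b e (9 / 10)) => //; lra.
Qed.

(** * Geometric decay against polynomial weights *)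

Lemma geometric_le_inv (R : realFieldType) (x : R) n : 0 <= x -> x <= 1 ->
  (1 - x) ^+ n * (1 + n%:R * x) <= 1.
Proof.
move=> x0 x1; elim: n => [|n IH]; first by rewrite expr0; lra.
apply: le_trans IH; rewrite exprSr -mulrA ler_wpM2l ?exprn_ge0 ?subr_ge0 //.
rewrite -(natr1 n).
have h := mulr_ge0 (sqr_ge0 x) (ler0n R n).
have := sqr_ge0 x; lra.
Qed.

(** Cut the exponent n into m blocks of length q, the quotient of n by m, and apply
    [geometric_le_inv] to each block. As x <= 1, the rounding costs only 1 + n x <= (m + 1) (1 + q
    x). *)
Lemma geometric_le_inv_pow (R : realFieldType) (x : R) n m : 0 <= x -> x <= 1 ->
  (1 - x) ^+ n * (1 + n%:R * x) ^+ m <= m.+1%:R ^+ m.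
Proof.
move=> x0 x1; case: m => [|m].
  by rewrite !expr0 mulr1 exprn_ile1 ?subr_ge0 // gerBl.
have u0 : 0 <= 1 - x by rewrite subr_ge0.
have u1 : 1 - x <= 1 by rewrite gerBl.
set q := (n %/ m.+1)%N.
have hq : (1 - x) ^+ n <= ((1 - x) ^+ q) ^+ m.+1.
  by rewrite -exprM ler_wiXn2l // leq_trunc_div.
have nx0 : 0 <= n%:R * x by rewrite mulr_ge0.
have hL : 0 <= 1 + n%:R * x by lra.
apply: (le_trans (ler_wpM2r (exprn_ge0 _ hL) hq)).
rewrite -exprMn lerXn2r ?nnegrE ?mulr_ge0 ?exprn_ge0 ?ler0n //.
have h1 : 1 + n%:R * x <= m.+2%:R * (1 + q%:R * x).
  have : (n <= m.+1 * q + m.+1)%N.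
    by rewrite addnC mulnC -mulSn ltnW // ltn_ceil.
  rewrite -(ler_nat R) natrD natrM => h.
  have := ler_wpM2r x0 h.
  have : m.+1%:R * x <= m.+1%:R by rewrite ler_piMr.
  have : 0 <= q%:R * x by rewrite mulr_ge0.
  rewrite -(natr1 m.+1); lra.
apply: (le_trans (ler_wpM2l (exprn_ge0 q u0) h1)).
have := ler_wpM2l (ler0n R m.+2) (geometric_le_inv q x0 x1); lra.
Qed.

Lemma rho_pow_le (R : realFieldType) n :
  (91 / 100 : R) ^+ n * n%:R ^+ 5 <= (200 / 3) ^+ 5.
Proof.
(* The constant is 200/3 = 6 / (9/100), with 6 = m + 1 for m = 5. *)
have := @geometric_le_inv_pow R (9 / 100) n 5.
have -> : 1 - 9 / 100 = 91 / 100 :> R by lra.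
move=> /(_ ltac:(lra) ltac:(lra)) h.
have h2 : (9 / 100 * n%:R) ^+ 5 <= (1 + n%:R * (9 / 100 : R)) ^+ 5.
  rewrite lerXn2r ?nnegrE ?addr_ge0 ?mulr_ge0 ?ler0n //; lra.
have p0 : 0 <= (91 / 100 : R) ^+ n by rewrite exprn_ge0 //; lra.
have := le_trans (ler_wpM2l p0 h2) h.
rewrite [(9 / 100 * n%:R) ^+ 5]exprMn => h3.
have : (9 / 100 : R) ^+ 5 * ((91 / 100 : R) ^+ n * n%:R ^+ 5) <=
  (9 / 100 : R) ^+ 5 * (200 / 3) ^+ 5.
  rewrite -exprMn.
  have -> : 9 / 100 * (200 / 3) = 6 :> R by lra.
  by rewrite mulrCA.
by rewrite ler_pM2l // exprn_gt0 //; lra.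
Qed.

(** The factor x on the right will absorb the squared sign kernel, which is at most 4 / x. The term
    (91/100)^n carries no x of its own and is paid for by 1 <= 36 n^2 x, whence the fifth power of n
    in [rho_pow_le]. *)
Lemma imaginary_decay (R : realFieldType) : exists2 C : R, 0 < C &
  forall (x u w : R) n, (0 < n)%N -> (36 * n%:R ^+ 2)^-1 <= x -> x <= 1 ->
  u <= 17 * n%:R * x ^+ 3 * (1 - x) ^+ n + 18 * (91 / 100) ^+ n ->
  w <= 24 * x ^+ 2 * (1 - x) ^+ n + 19 * (91 / 100) ^+ n ->
  (2 * u + 2 * w) * (n%:R * (1 + n%:R * x) ^+ 2) <= C * x.
Proof.
(* 82 = 2 (17 + 24), 74 = 2 (18 + 19), 144 = 4 . 36, and 5^4 is [geometric_le_inv_pow] at exponent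
   4. *)
exists (82 * 5 ^+ 4 + 74 * 144 * (200 / 3) ^+ 5).
  have : 0 < (200 / 3 : R) ^+ 5 by rewrite exprn_gt0 //; lra.
  lra.
move=> x u w n n0 x_ge x1 hu hw.
have n0' : 0 < n%:R :> R by rewrite ltr0n.
have n1 : 1 <= n%:R :> R by rewrite ler1n.
have hx : 1 <= 36 * n%:R ^+ 2 * x.
  by move: x_ge; rewrite -[X in X <= _]div1r ler_pdivrMr ?mulr_gt0 ?exprn_gt0 // mulrC.
have x0 : 0 <= x by apply: le_trans x_ge; rewrite invr_ge0 mulr_ge0 ?exprn_ge0.
have hg := geometric_le_inv_pow n 4 x0 x1.
have hr := rho_pow_le R n.
set N := n%:R in hu hw n0' n1 hx hg hr *.
set g := (1 - x) ^+ n in hu hw hg.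
set p := (91 / 100) ^+ n in hu hw hr.
set L := 1 + N * x in hg *.
have g0 : 0 <= g by rewrite exprn_ge0 // subr_ge0.
have p0 : 0 <= p by rewrite exprn_ge0 //; lra.
have Nx0 : 0 <= N * x by rewrite mulr_ge0 // ltW.
have L0 : 0 <= L by rewrite /L; lra.
have L2 : 0 <= N * L ^+ 2 by rewrite mulr_ge0 ?exprn_ge0 // ltW.
have h1 : (2 * u + 2 * w) * (N * L ^+ 2) <=
   (2 * (17 * N * x ^+ 3 * g + 18 * p) + 2 * (24 * x ^+ 2 * g + 19 * p)) * (N * L ^+ 2).
  by rewrite ler_wpM2r //; lra.
apply: (le_trans h1).
have h2 : N ^+ 2 * x ^+ 2 * (g * L ^+ 2) <= g * L ^+ 4.
  rewrite (_ : g * L ^+ 4 = L ^+ 2 * (g * L ^+ 2)); last by ring.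
  apply: ler_wpM2r; first by rewrite mulr_ge0 // exprn_ge0.
  by rewrite -exprMn lerXn2r ?nnegrE // /L; lra.
have h3 : N * x * (g * L ^+ 2) <= g * L ^+ 4.
  rewrite (_ : g * L ^+ 4 = L ^+ 2 * (g * L ^+ 2)); last by ring.
  apply: ler_wpM2r; first by rewrite mulr_ge0 // exprn_ge0.
  rewrite /L; have := sqr_ge0 (N * x); lra.
have h4 : p * (N * L ^+ 2) <= 144 * (200 / 3) ^+ 5 * x.
  have hL : L <= 2 * N.
    rewrite /L.
    have : N * x <= N by rewrite ler_piMr // ltW.
    by lra.
  have hL2 : L ^+ 2 <= (2 * N) ^+ 2 by rewrite lerXn2r ?nnegrE //; lra.
  have := ler_wpM2l (mulr_ge0 p0 (ltW n0')) hL2.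
  have k1 : 0 <= p * N * (2 * N) ^+ 2 by rewrite !mulr_ge0 ?exprn_ge0 // ?mulr_ge0 // ltW.
  have := ler_wpM2l k1 hx.
  have := ler_wpM2r x0 hr.
  by lra.
have h5 := ler_wpM2r x0 (le_trans h2 hg).
have h6 := ler_wpM2r x0 (le_trans h3 hg).
lra.
Qed.

Lemma real_decay (R : realFieldType) : exists2 C : R, 0 < C &
  forall (x u w : R) n, (0 < n)%N -> 0 <= x -> x <= 1 ->
  u <= 5 * n%:R * x ^+ 2 * (1 - x) ^+ n + 18 * (91 / 100) ^+ n ->
  w <= 24 * x ^+ 2 * (1 - x) ^+ n + 19 * (91 / 100) ^+ n ->
  (2 * u + 2 * w) * (n%:R * (1 + n%:R * x) ^+ 2) <= C.
Proof.
exists (58 * 5 ^+ 4 + 74 * 4 * (200 / 3) ^+ 5).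
  have : 0 < (200 / 3 : R) ^+ 5 by rewrite exprn_gt0 //; lra.
  lra.
move=> x u w n n0 x0 x1 hu hw.
have n0' : 0 < n%:R :> R by rewrite ltr0n.
have n1 : 1 <= n%:R :> R by rewrite ler1n.
have hg := geometric_le_inv_pow n 4 x0 x1.
have hr := rho_pow_le R n.
set N := n%:R in hu hw n0' n1 hg hr *.
set g := (1 - x) ^+ n in hu hw hg.
set p := (91 / 100) ^+ n in hu hw hr.
set L := 1 + N * x in hg *.
have g0 : 0 <= g by rewrite exprn_ge0 // subr_ge0.
have p0 : 0 <= p by rewrite exprn_ge0 //; lra.
have Nx0 : 0 <= N * x by rewrite mulr_ge0 // ltW.
have L0 : 0 <= L by rewrite /L; lra.
have L2 : 0 <= N * L ^+ 2 by rewrite mulr_ge0 ?exprn_ge0 // ltW.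
have h1 : (2 * u + 2 * w) * (N * L ^+ 2) <=
   (2 * (5 * N * x ^+ 2 * g + 18 * p) + 2 * (24 * x ^+ 2 * g + 19 * p)) * (N * L ^+ 2).
  by rewrite ler_wpM2r //; lra.
apply: (le_trans h1).
have h2 : N ^+ 2 * x ^+ 2 * (g * L ^+ 2) <= g * L ^+ 4.
  rewrite (_ : g * L ^+ 4 = L ^+ 2 * (g * L ^+ 2)); last by ring.
  apply: ler_wpM2r; first by rewrite mulr_ge0 // exprn_ge0.
  by rewrite -exprMn lerXn2r ?nnegrE // /L; lra.
have h3 : N * x ^+ 2 * (g * L ^+ 2) <= N ^+ 2 * x ^+ 2 * (g * L ^+ 2).
  apply: ler_wpM2r; first by rewrite mulr_ge0 // exprn_ge0.
  apply: ler_wpM2r; first exact: sqr_ge0.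
  by rewrite expr2 ler_peMr // ltW.
have h4 : p * (N * L ^+ 2) <= 4 * (200 / 3) ^+ 5.
  have hL : L <= 2 * N.
    rewrite /L.
    have : N * x <= N by rewrite ler_piMr // ltW.
    by lra.
  have hL2 : L ^+ 2 <= (2 * N) ^+ 2 by rewrite lerXn2r ?nnegrE //; lra.
  have := ler_wpM2l (mulr_ge0 p0 (ltW n0')) hL2.
  have k1 : p * N ^+ 3 <= p * N ^+ 5 by rewrite ler_wpM2l // ler_weXn2l.
  by lra.
have h5 := le_trans h2 hg.
lra.
Qed.

(** As (s + j)^2 <= 2 (s^2 + j^2), each term is at most 2 s^2 (1 / (s + j - 1) - 1 / (s + j)), and
    these differences telescope. *)
Lemma sum_inv_sqr_le (R : realFieldType) (s : R) n : 0 < s ->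
  \sum_(1 <= j < n.+1) s ^+ 2 / (s ^+ 2 + j%:R ^+ 2) <= 2 * s.
Proof.
move=> s0.
suff : \sum_(1 <= j < n.+1) s ^+ 2 / (s ^+ 2 + j%:R ^+ 2) <=
    2 * s ^+ 2 * (s^-1 - (s + n%:R)^-1).
  move=> /le_trans; apply.
  rewrite mulrBr expr2 mulrA mulfK ?gt_eqF // gerBl.
  by rewrite !mulr_ge0 ?invr_ge0 ?addr_ge0 //; exact: ltW.
elim: n => [|n IH]; first by rewrite big_geq // addr0 subrr mulr0.
rewrite big_nat_recr //=.
have hn : 0 <= n%:R :> R by [].
suff : s ^+ 2 / (s ^+ 2 + n.+1%:R ^+ 2) <=
   2 * s ^+ 2 * ((s + n%:R)^-1 - (s + n.+1%:R)^-1) by lra.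
rewrite -(natr1 n); set x := n%:R in hn *.
have d1 : 0 < s + x by lra.
have d2 : 0 < s + (x + 1) by lra.
have d3 : 0 < s ^+ 2 + (x + 1) ^+ 2 by rewrite addr_gt0 ?exprn_gt0 //; lra.
have -> : 2 * s ^+ 2 * ((s + x)^-1 - (s + (x + 1))^-1) =
    2 * s ^+ 2 / ((s + x) * (s + (x + 1))).
  by field; rewrite !gt_eqF.
rewrite ler_pdivrMr // mulrAC ler_pdivlMr ?mulr_gt0 //.
have key : (s + x) * (s + (x + 1)) <= 2 * (s ^+ 2 + (x + 1) ^+ 2).
  by have := sqr_ge0 (s - (x + 1)); nra.
have := ler_wpM2l (sqr_ge0 s) key; lra.
Qed.

(** For j <= k the lower bound on x j gives a term at most S^2 / (S^2 + j^2) with S = 6 sqrt k. Each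
    half of the range contributes at most 12 sqrt k and the term j = 0 at most 1. *)
Lemma inv_sum_le (R : realType) (x : nat -> R) k : (0 < k)%N ->
  (forall j, 0 <= x j) -> (forall j, (j <= 2 * k + 1)%N -> x (2 * k + 1 - j)%N = x j) ->
  (forall j, (j <= k)%N -> j%:R ^+ 2 / (36 * k%:R ^+ 2) <= x j) ->
  \sum_(0 <= j < 2 * k + 1) (1 + k%:R * x j)^-1 <= 25 * Num.sqrt k%:R.
Proof.
move=> k0 x0 xsym xge.
have k0' : 0 < k%:R :> R by rewrite ltr0n.
have s1 : 1 <= Num.sqrt k%:R :> R by rewrite -[X in X <= _]sqrtr1 ler_sqrt // ler1n.
have Ss : Num.sqrt k%:R ^+ 2 = k%:R :> R by rewrite sqr_sqrtr // ltW.
set s := Num.sqrt k%:R in s1 Ss *.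
pose r j := (1 + k%:R * x j)^-1.
have r1 j : r j <= 1.
  by rewrite /r invf_le1 ?lerDl ?ltr_wpDr ?mulr_ge0 // ltW.
have half : \sum_(1 <= j < k.+1) r j <= 12 * s.
  apply: le_trans (_ : \sum_(1 <= j < k.+1) (6 * s) ^+ 2 / ((6 * s) ^+ 2 + j%:R ^+ 2) <= _).
    rewrite !big_nat ler_sum // => j /andP[j1 jk].
    have := xge _ jk; rewrite ler_pdivrMr ?mulr_gt0 ?exprn_gt0 // => h.
    have d1 : 0 < (6 * s) ^+ 2 + j%:R ^+ 2 :> R.
      by rewrite ltr_pwDl ?exprn_gt0 ?exprn_ge0 //; lra.
    have kx0 : 0 <= k%:R * x j by rewrite mulr_ge0 // ltW.
    have d2 : 0 < 1 + k%:R * x j by lra.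
    rewrite /r -[X in X <= _]div1r ler_pdivrMr // mulrAC ler_pdivlMr //.
    rewrite !exprMn Ss.
    have := ler_wpM2l (ltW k0') (x0 j); lra.
  have := @sum_inv_sqr_le R (6 * s) k ltac:(lra); lra.
have -> : (2 * k + 1 = k.+1 + k)%N by lia.
rewrite big_ltn //.
rewrite (@big_cat_nat _ _ _ k.+1) ?leq_addr //=.
have -> : \sum_(k.+1 <= j < k.+1 + k) (1 + k%:R * x j)^-1 = \sum_(1 <= j < k.+1) r j.
  rewrite -[X in \sum_(X <= _ < _) _]add1n big_addn addnK [RHS]big_nat_rev /=.
  apply: eq_big_nat => j /andP[j1 jk]; rewrite /r -xsym; last by lia.
  by congr (1 + _ * x _)^-1; lia.
have : (1 + k%:R * x 0)^-1 <= 1 by exact: r1.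
rewrite -/(\sum_(1 <= j < k.+1) r j); lra.
Qed.

(** * Binary weight digit by digit *)

Lemma trunc_log2_le n : (trunc_log 2 n <= n)%N.
Proof.
case: n => [|n]; first by rewrite trunc_log0.
have := @trunc_logP 2 n.+1 isT isT; apply: leq_trans.
exact/ltnW/ltn_expl.
Qed.

Lemma binary_weight_widen n m : (trunc_log 2 n < m)%N ->
  binary_weight n = (\sum_(0 <= i < m) odd (n %/ 2 ^ i))%N.
Proof.
move=> lt_m; rewrite (big_cat_nat (leq0n _) lt_m) /= -[LHS]addn0; congr addn.
rewrite big_nat big1 // => i /andP[le_i _].
by rewrite divn_small // (leq_trans (trunc_log_ltn n (ltnSn 1))) // leq_pexp2l.
Qed.

Lemma binary_weight_bit n (b : bool) :
  binary_weight (b + n.*2) = (b + binary_weight n)%N.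
Proof.
rewrite (@binary_weight_widen _ (b + n.*2).+2); last first.
  by rewrite ltnS (leq_trans (trunc_log2_le _)).
rewrite (@binary_weight_widen n (b + n.*2).+1); last first.
  by rewrite ltnS (leq_trans (trunc_log2_le _)) // -addnn; lia.
rewrite big_nat_recl //= expn0 divn1 oddD odd_double addbF oddb; congr addn.
apply: eq_bigr => i _; rewrite expnS divnMA; congr (nat_of_bool (odd (_ %/ _))).
by rewrite divn2 halfD half_double odd_double andbF add0n; case: b.
Qed.

Lemma binary_weight0 : binary_weight 0 = 0.
Proof. by rewrite /binary_weight trunc_log0 big_nat1. Qed.

Lemma binary_weight_double n : binary_weight n.*2 = binary_weight n.
Proof. exact: binary_weight_bit n false. Qed.

Lemma binary_weight_doubleS n : binary_weight n.*2.+1 = (binary_weight n).+1.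
Proof. exact: binary_weight_bit n true. Qed.

Lemma binary_weight_le k n : (n < 2 ^ k)%N -> (binary_weight n <= k)%N.
Proof.
elim: k n => [|k IH] n.
  by rewrite expn0 ltnS leqn0 => /eqP->; rewrite binary_weight0.
rewrite expnS mul2n -{2}(odd_double_half n) binary_weight_bit => n_lt.
have /IH : (n./2 < 2 ^ k)%N by rewrite ltn_half_double.
by case: (odd n) => /= h; lia.
Qed.

Lemma binary_weight_ones k : binary_weight (2 ^ k - 1) = k.
Proof.
elim: k => [|k IH]; first by rewrite expn0 subnn binary_weight0.
have -> : (2 ^ k.+1 - 1 = (2 ^ k - 1).*2.+1)%N.
  by rewrite expnS; have := expn_gt0 2 k; lia.
by rewrite binary_weight_doubleS IH.
Qed.

Lemma sum_nat_double (V : nmodType) n (F : nat -> V) :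
  \sum_(0 <= i < n.*2) F i = \sum_(0 <= i < n) (F i.*2 + F i.*2.+1).
Proof.
elim: n => [|n IH]; first by rewrite !big_geq.
by rewrite doubleS !big_nat_recr //= IH addrA.
Qed.

(** * Addition with carries *)

(** [c] is the carry into the lowest digit and [c'] the carry out of the highest: for fixed t this
    is an entry of the transfer matrix of a k-digit adder. *)
Definition carry_sum (R : nmodType) (k t c c' : nat) (f : nat -> R) : R :=
  \sum_(0 <= a < 2 ^ k) \sum_(0 <= b < 2 ^ k | (a + b + c == t + c' * 2 ^ k)%N)
    f (binary_weight a + binary_weight b)%N.

Lemma carry_sum_double (R : nmodType) k t c c' (f : nat -> R) :
  carry_sum k.+1 t c c' f =
  \sum_(0 <= a < 2 ^ k) \sum_(0 <= b < 2 ^ k)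
    ((if (a.*2 + b.*2 + c == t + (c' * 2 ^ k).*2)%N
      then f (binary_weight a + binary_weight b)%N else 0)
   + (if (a.*2 + b.*2 + c.+1 == t + (c' * 2 ^ k).*2)%N
      then f (binary_weight a + binary_weight b).+1 else 0) *+ 2
   + (if (a.*2 + b.*2 + c.+2 == t + (c' * 2 ^ k).*2)%N
      then f (binary_weight a + binary_weight b).+2 else 0)).
Proof.
rewrite /carry_sum expnS mul2n sum_nat_double; apply: eq_bigr => a _.
rewrite !(big_mkcond (fun b => _ == _)) !sum_nat_double -big_split /=.
apply: eq_bigr => b _; rewrite !binary_weight_double !binary_weight_doubleS.
by rewrite -doubleMr !(addnS, addSn) mulr2n !addrA.
Qed.

(** The low digit of t and the incoming carry fix the parity of the low digits of a and b. If it is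
    even, the pair (0, 0) passes on carry 0 and (1, 1) passes on carry 1; if odd, the two mixed
    pairs pass on the same carry. The next three lemmas are the remaining cases. *)
Lemma carry_sum_even0 (R : nmodType) k t c' (f : nat -> R) :
  carry_sum k.+1 t.*2 0 c' f =
  carry_sum k t 0 c' f + carry_sum k t 1 c' (fun n => f n.+2).
Proof.
rewrite carry_sum_double /carry_sum -big_split; apply: eq_bigr => a _.
rewrite !(big_mkcond (fun b => _ == _)) -big_split; apply: eq_bigr => b _ /=.
set x := (c' * 2 ^ k)%N.
have -> : (a.*2 + b.*2 + 0 == t.*2 + x.*2 = (a + b + 0 == t + x))%N by lia.
have -> : (a.*2 + b.*2 + 1 == t.*2 + x.*2 = false)%N by lia.
have -> : (a.*2 + b.*2 + 2 == t.*2 + x.*2 = (a + b + 1 == t + x))%N by lia.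
by rewrite mul0rn addr0.
Qed.

Lemma carry_sum_even1 (R : nmodType) k t c' (f : nat -> R) :
  carry_sum k.+1 t.*2 1 c' f = carry_sum k t 1 c' (fun n => f n.+1) *+ 2.
Proof.
rewrite carry_sum_double /carry_sum -sumrMnl; apply: eq_bigr => a _.
rewrite !(big_mkcond (fun b => _ == _)) -sumrMnl; apply: eq_bigr => b _ /=.
set x := (c' * 2 ^ k)%N.
have -> : (a.*2 + b.*2 + 1 == t.*2 + x.*2 = false)%N by lia.
have -> : (a.*2 + b.*2 + 2 == t.*2 + x.*2 = (a + b + 1 == t + x))%N by lia.
have -> : (a.*2 + b.*2 + 3 == t.*2 + x.*2 = false)%N by lia.
by rewrite add0r addr0.
Qed.

Lemma carry_sum_odd0 (R : nmodType) k t c' (f : nat -> R) :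
  carry_sum k.+1 t.*2.+1 0 c' f = carry_sum k t 0 c' (fun n => f n.+1) *+ 2.
Proof.
rewrite carry_sum_double /carry_sum -sumrMnl; apply: eq_bigr => a _.
rewrite !(big_mkcond (fun b => _ == _)) -sumrMnl; apply: eq_bigr => b _ /=.
set x := (c' * 2 ^ k)%N.
have -> : (a.*2 + b.*2 + 0 == t.*2.+1 + x.*2 = false)%N by lia.
have -> : (a.*2 + b.*2 + 1 == t.*2.+1 + x.*2 = (a + b + 0 == t + x))%N by lia.
have -> : (a.*2 + b.*2 + 2 == t.*2.+1 + x.*2 = false)%N by lia.
by rewrite add0r addr0.
Qed.

Lemma carry_sum_odd1 (R : nmodType) k t c' (f : nat -> R) :
  carry_sum k.+1 t.*2.+1 1 c' f =
  carry_sum k t 0 c' f + carry_sum k t 1 c' (fun n => f n.+2).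
Proof.
rewrite carry_sum_double /carry_sum -big_split; apply: eq_bigr => a _.
rewrite !(big_mkcond (fun b => _ == _)) -big_split; apply: eq_bigr => b _ /=.
set x := (c' * 2 ^ k)%N.
have -> : (a.*2 + b.*2 + 1 == t.*2.+1 + x.*2 = (a + b + 0 == t + x))%N by lia.
have -> : (a.*2 + b.*2 + 2 == t.*2.+1 + x.*2 = false)%N by lia.
have -> : (a.*2 + b.*2 + 3 == t.*2.+1 + x.*2 = (a + b + 1 == t + x))%N by lia.
by rewrite mul0rn addr0.
Qed.

Lemma carry_sum_k0 (R : nmodType) c c' (f : nat -> R) :
  carry_sum 0 0 c c' f = if c == c' then f 0 else 0.
Proof.
rewrite /carry_sum expn0 big_nat1 big_mkcond big_nat1 binary_weight0.
by rewrite !add0n muln1.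
Qed.

(** The trace of the transfer matrix: the outgoing carry re-enters at the bottom, which is addition
    modulo 2^k - 1. *)
Definition cyclic_sum (R : nmodType) (k t : nat) (f : nat -> R) : R :=
  carry_sum k t 0 0 f + carry_sum k t 1 1 f.

(* A pair with a = 2 ^ k - 1 is counted by cyclic_sum although a is not a
   residue, but its weight is at least k. *)
Lemma card_S_set k t : (t < 2 ^ k - 1)%N ->
  #|S_set t k| = cyclic_sum k t (fun n => (n < k)%N : nat).
Proof.
move=> t_lt.
have k2 : (0 < 2 ^ k)%N by rewrite expn_gt0.
set M := (2 ^ k - 1)%N in t_lt *.
have EM : (2 ^ k = M.+1)%N by rewrite /M; lia.
pose g a b := (((a + b == t) + (a + b == t + M)) *
   (binary_weight a + binary_weight b < k))%N.
have -> : cyclic_sum k t (fun n => (n < k)%N : nat) =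
    \sum_(0 <= a < M.+1) \sum_(0 <= b < M.+1) g a b.
  rewrite /cyclic_sum /carry_sum -big_split EM; apply: eq_bigr => a _ /=.
  rewrite !(big_mkcond (fun b => _ == _)) -big_split; apply: eq_bigr => b _ /=.
  rewrite /g !addn0 ?mul0n ?addn0 ?mul1n ?addnS ?addn1 ?eqSS ?addn0.
  by case: (_ == t); case: (_ == _); case: (_ < k)%N.
have last a : (g a M = 0)%N /\ (g M a = 0)%N.
  have wM : binary_weight M = k by exact: binary_weight_ones.
  by rewrite /g wM !ltnNge leq_addl leq_addr !muln0.
rewrite big_nat_recr //= [X in _ + X]big1 ?addr0; last by move=> i _; case: (last i).
under eq_bigr => a _ do rewrite big_nat_recr //= (last a).1 addr0.
rewrite big_mkord; under eq_bigr => a _ do rewrite big_mkord.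
rewrite pair_bigA /= -sum1_card big_mkcond /=; apply: eq_bigr => -[a b] _ /=.
rewrite inE /g /=.
have -> : (a + b == t %[mod M])%N = ((a + b == t) || (a + b == t + M))%N.
  have a_lt : (a < M)%N := ltn_ord a.
  have b_lt : (b < M)%N := ltn_ord b.
  rewrite (modn_small t_lt).
  have [ab_lt|ab_ge] := ltnP (a + b) M.
    rewrite modn_small //.
    have -> : (a + b == t + M)%N = false by lia.
    by rewrite orbF.
  rewrite -{1}(subnK ab_ge) modnDr modn_small; last by lia.
  by lia.
case: (_ < k)%N; last by rewrite andbF muln0.
rewrite andbT muln1.
have [->|] := eqVneq (a + b)%N t; last by case: eqP.
by have -> : (t == t + M)%N = false by lia.
Qed.

(** * Averages over t and the moments of p and d *)

(** All 2^k values of t are averaged, 0 and 2^k - 1 included, so that the digits of t are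
    independent fair bits. *)
Definition mean (R : realFieldType) k (F : nat -> R) : R :=
  (\sum_(0 <= t < 2 ^ k) F t) / 2 ^+ k.

Lemma mean_step (R : realFieldType) k (F : nat -> R) :
  mean k.+1 F = mean k (fun t => (F t.*2 + F t.*2.+1) / 2).
Proof.
rewrite /mean expnS mul2n sum_nat_double -mulr_suml exprSr invfM.
by rewrite mulrAC mulrA.
Qed.

Lemma mean0 (R : realFieldType) (F : nat -> R) : mean 0 F = F 0.
Proof. by rewrite /mean expn0 big_nat1 expr0 divr1. Qed.

Lemma eq_mean (R : realFieldType) k (F G : nat -> R) : F =1 G -> mean k F = mean k G.
Proof. by move=> FG; rewrite /mean; congr (_ / _); apply: eq_bigr => t _. Qed.

Lemma meanD (R : realFieldType) k (F G : nat -> R) :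
  mean k (fun t => F t + G t) = mean k F + mean k G.
Proof. by rewrite /mean big_split mulrDl. Qed.

Lemma meanZ (R : realFieldType) k c (F : nat -> R) :
  mean k (fun t => c * F t) = c * mean k F.
Proof. by rewrite /mean -mulr_sumr mulrA. Qed.

Lemma meanB (R : realFieldType) k (F G : nat -> R) :
  mean k (fun t => F t - G t) = mean k F - mean k G.
Proof.
rewrite -mulN1r -meanZ -meanD; apply: eq_mean => t; by rewrite mulN1r.
Qed.

Lemma mean_cst (R : realFieldType) k (c : R) : mean k (fun=> c) = c.
Proof.
rewrite /mean big_const_nat subn0 iter_addr_0 -(mulr_natr c) natrX mulfK //.
Qed.

Lemma ler_mean (R : realFieldType) k (F G : nat -> R) :
  (forall t, (t < 2 ^ k)%N -> F t <= G t) -> mean k F <= mean k G.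
Proof.
move=> FG; rewrite /mean ler_wpM2r ?invr_ge0 ?exprn_ge0 //.
by rewrite !big_nat ler_sum // => t /andP[_]; exact: FG.
Qed.

Lemma mean_ge0 (R : realFieldType) k (F : nat -> R) :
  (forall t, 0 <= F t) -> 0 <= mean k F.
Proof. by move=> F0; rewrite -(mean_cst k (0 : R)) ler_mean. Qed.

(* The step from t to t.*2 + r for p = pr + i pi and d = dr + i di is
   (p, d) -> ((1 - al) p + i be d + s d / 2, d / 2 + s (al p - i be d)),
   with s = 1 for r = 0 and s = -1 for r = 1. *)
Record bit_recurrence (R : realFieldType) (al be : R) (pr pi dr di : nat -> nat -> R)
    : Prop := {
  bit_pr0 : forall k t,
    pr k.+1 t.*2 = (1 - al) * pr k t - be * di k t + dr k t / 2;
  bit_pr1 : forall k t,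
    pr k.+1 t.*2.+1 = (1 - al) * pr k t - be * di k t - dr k t / 2;
  bit_pi0 : forall k t,
    pi k.+1 t.*2 = (1 - al) * pi k t + be * dr k t + di k t / 2;
  bit_pi1 : forall k t,
    pi k.+1 t.*2.+1 = (1 - al) * pi k t + be * dr k t - di k t / 2;
  bit_dr0 : forall k t,
    dr k.+1 t.*2 = dr k t / 2 + (al * pr k t + be * di k t);
  bit_dr1 : forall k t,
    dr k.+1 t.*2.+1 = dr k t / 2 - (al * pr k t + be * di k t);
  bit_di0 : forall k t,
    di k.+1 t.*2 = di k t / 2 + (al * pi k t - be * dr k t);
  bit_di1 : forall k t,
    di k.+1 t.*2.+1 = di k t / 2 - (al * pi k t - be * dr k t)
}.

Definition moment_p (R : realFieldType) (pr pi : nat -> nat -> R) k :=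
  mean k (fun t => pr k t ^+ 2 + pi k t ^+ 2).

Definition moment_pd (R : realFieldType) be (pr pi dr di : nat -> nat -> R) k :=
  mean k (fun t => be * (pi k t * dr k t - pr k t * di k t)).

Lemma bit_moment_recurrence (R : realFieldType) (al be : R) pr pi dr di :
  be ^+ 2 = al * (1 - al) -> bit_recurrence al be pr pi dr di ->
  moment_recurrence al (moment_p pr pi) (moment_p dr di) (moment_pd be pr pi dr di).
Proof.
move=> be2 [r0 r1 i0 i1 s0 s1 j0 j1]; split=> n.
- by apply: mean_ge0 => t; rewrite addr_ge0 ?sqr_ge0.
- by apply: mean_ge0 => t; rewrite addr_ge0 ?sqr_ge0.
- rewrite -be2 /moment_p /moment_pd mean_step -!meanZ -!meanD.
  by apply: eq_mean => t; rewrite r0 r1 i0 i1; field.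
- rewrite -be2 /moment_p /moment_pd mean_step -!meanZ -!meanD -meanB.
  by apply: eq_mean => t; rewrite s0 s1 j0 j1; field.
- rewrite -be2 /moment_p /moment_pd mean_step -!meanZ -!meanD.
  by apply: eq_mean => t; rewrite r0 r1 i0 i1 s0 s1 j0 j1; field.
Qed.

Lemma moment_pd_le (R : realFieldType) (be : R) pr pi dr di n : be ^+ 2 <= 1 / 4 ->
  `|moment_pd be pr pi dr di n| <= (moment_p pr pi n + moment_p dr di n) / 4.
Proof.
move=> be2.
have hb : - (1 / 2) <= be <= 1 / 2 by apply/andP; split; nra.
have key t : - ((pr n t ^+ 2 + pi n t ^+ 2 + (dr n t ^+ 2 + di n t ^+ 2)) / 4) <=
    be * (pi n t * dr n t - pr n t * di n t) <=
    (pr n t ^+ 2 + pi n t ^+ 2 + (dr n t ^+ 2 + di n t ^+ 2)) / 4.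
  set a := pr n t; set b := pi n t; set c := dr n t; set d := di n t.
  rewrite -ler_norml normrM.
  have h1 : `|be| <= 1 / 2 by rewrite ler_norml.
  have h2 : `|b * c - a * d| <= (a ^+ 2 + b ^+ 2 + (c ^+ 2 + d ^+ 2)) / 2.
    rewrite ler_norml.
    have := sqr_ge0 (b - c); have := sqr_ge0 (b + c).
    have := sqr_ge0 (a - d); have := sqr_ge0 (a + d).
    by move=> k1 k2 k3 k4; apply/andP; split; lra.
  have := ler_pM (normr_ge0 _) (normr_ge0 _) h1 h2; lra.
have E : (moment_p pr pi n + moment_p dr di n) / 4 =
    mean n (fun t => (pr n t ^+ 2 + pi n t ^+ 2 + (dr n t ^+ 2 + di n t ^+ 2)) / 4).
  by rewrite /moment_p -meanD mulrC -meanZ; apply: eq_mean => t; rewrite mulrC.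
rewrite ler_norml E; apply/andP; split.
  rewrite -mulN1r -meanZ; apply: ler_mean => t _.
  by rewrite mulN1r; case/andP: (key t).
by apply: ler_mean => t _; case/andP: (key t).
Qed.

(** The mean of p d is halved by each step: averaging over the digit turns p d into (d / 2) (((1 -
    al) p + i be d) + (al p - i be d)) = p d / 2. It starts at 0, and its imaginary part is the
    quantity here. *)
Lemma mean_pd_imaginary (R : realFieldType) (al be : R) pr pi dr di n :
  bit_recurrence al be pr pi dr di -> dr 0 0 = 0 -> di 0 0 = 0 ->
  mean n (fun t => pr n t * di n t + pi n t * dr n t) = 0.
Proof.
move=> [r0 r1 i0 i1 s0 s1 j0 j1] dr0 di0.
elim: n => [|n IH]; first by rewrite mean0 dr0 di0 !mulr0 addr0.
rewrite mean_step -[RHS](mulr0 (1 / 2)) -IH -meanZ.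
by apply: eq_mean => t; rewrite r0 r1 i0 i1 s0 s1 j0 j1; field.
Qed.

(** Averaging over the digit turns d into d / 2, so the mean of [di] stays 0 and the mean of [pr] is
    just multiplied by 1 - al. *)
Lemma mean_pr (R : realFieldType) (al be : R) pr pi dr di n :
  bit_recurrence al be pr pi dr di -> pr 0 0 = 1 -> di 0 0 = 0 ->
  mean n (pr n) = (1 - al) ^+ n.
Proof.
move=> [r0 r1 i0 i1 s0 s1 j0 j1] pr0 di0.
have di_mean m : mean m (di m) = 0.
  elim: m => [|m IH]; first by rewrite mean0.
  rewrite mean_step -[RHS](mulr0 (1 / 2)) -IH -meanZ.
  by apply: eq_mean => t; rewrite j0 j1; field.
elim: n => [|n IH]; first by rewrite mean0 expr0.
rewrite mean_step exprS -IH -meanZ -[RHS]subr0 -(mulr0 be) -(di_mean n) -meanZ -meanB.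
by apply: eq_mean => t; rewrite r0 r1; field.
Qed.

Lemma variance_bound (R : realFieldType) (al be : R) pr pi dr di n :
  bit_recurrence al be pr pi dr di -> be ^+ 2 = al * (1 - al) -> 0 <= al -> al <= 1 ->
  pr 0 0 = 1 -> pi 0 0 = 0 -> dr 0 0 = 0 -> di 0 0 = 0 ->
  mean n (fun t => (pr n t - (1 - al) ^+ n) ^+ 2) <=
  5 * n%:R * al ^+ 2 * (1 - al) ^+ n + 18 * (91 / 100) ^+ n.
Proof.
move=> H be2 al0 al1 pr0 pi0 dr0 di0.
have M := bit_moment_recurrence be2 H.
set a := moment_p pr pi in M *; set b := moment_p dr di in M *.
set e := moment_pd _ _ _ _ _ in M *.
have a0 : a 0 = 1 by rewrite /a /moment_p mean0 pr0 pi0; lra.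
have b0 : b 0 = 0 by rewrite /b /moment_p mean0 dr0 di0; lra.
have e0 : e 0 = 0 by rewrite /e /moment_pd mean0 dr0 di0; lra.
(* The imaginary part of p is given away here: the variance of [pr] is at most the mean of |p|^2
   minus the squared mean. *)
have E : mean n (fun t => (pr n t - (1 - al) ^+ n) ^+ 2) <= a n - (1 - al) ^+ (2 * n).
  have -> : mean n (fun t => (pr n t - (1 - al) ^+ n) ^+ 2) =
      mean n (fun t => pr n t ^+ 2) - (1 - al) ^+ (2 * n).
    transitivity (mean n (fun t => pr n t ^+ 2 - 2 * (1 - al) ^+ n * pr n t
        + ((1 - al) ^+ n) ^+ 2)).
      by apply: eq_mean => t; ring.
    rewrite meanD meanB meanZ mean_cst (mean_pr n H) // mulnC exprM; ring.
  by rewrite lerB // ler_mean // => t _; rewrite lerDl sqr_ge0.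
have p0 : 0 <= (91 / 100 : R) ^+ n by rewrite exprn_ge0 //; lra.
have [al_le|al_gt] := lerP al (1 / 10).
  have := variance_le_small n M al0 al_le e0 a0 b0; lra.
have el m : `|e m| <= (a m + b m) / 4.
  by apply: moment_pd_le; have := sqr_ge0 (al - 1 / 2); lra.
have := moments_le_large n M al0 al1 el (ltW al_gt); rewrite a0 b0.
have : 0 <= n%:R * al ^+ 2 * (1 - al) ^+ n by rewrite !mulr_ge0 ?exprn_ge0 ?subr_ge0.
have : 0 <= (1 - al) ^+ (2 * n) by rewrite exprn_ge0 // subr_ge0.
have := moment_b_ge0 M n; lra.
Qed.

Lemma imaginary_bound (R : realFieldType) (al be : R) pr pi dr di n :
  bit_recurrence al be pr pi dr di -> be ^+ 2 = al * (1 - al) -> 0 <= al -> al <= 1 ->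
  pr 0 0 = 1 -> pi 0 0 = 0 -> dr 0 0 = 0 -> di 0 0 = 0 ->
  mean n (fun t => pi n t ^+ 2) <=
  17 * n%:R * al ^+ 3 * (1 - al) ^+ n + 18 * (91 / 100) ^+ n.
Proof.
move=> H be2 al0 al1 pr0 pi0 dr0 di0.
have M := bit_moment_recurrence be2 H.
set a := moment_p pr pi in M *; set b := moment_p dr di in M *.
set e := moment_pd _ _ _ _ _ in M *.
have a0 : a 0 = 1 by rewrite /a /moment_p mean0 pr0 pi0; lra.
have b0 : b 0 = 0 by rewrite /b /moment_p mean0 dr0 di0; lra.
have e0 : e 0 = 0 by rewrite /e /moment_pd mean0 dr0 di0; lra.
have p0 : 0 <= (91 / 100 : R) ^+ n by rewrite exprn_ge0 //; lra.
have [al_le|al_gt] := lerP al (1 / 10).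
  pose I m := mean m (fun t => pi m t ^+ 2); pose K m := mean m (fun t => di m t ^+ 2).
  suff : I n <= 17 * n%:R * al ^+ 3 * (1 - al) ^+ n by rewrite /I; lra.
  have f0 m := mean_pd_imaginary m H dr0 di0.
  case: (H) => r0 r1 i0 i1 s0 s1 j0 j1.
  apply: (@imaginary_moment_le_small _ al a b e I K) => // [m|m|||m|m].
  - by apply: mean_ge0 => t; exact: sqr_ge0.
  - by apply: mean_ge0 => t; exact: sqr_ge0.
  - by rewrite /I mean0 pi0; lra.
  - by rewrite /K mean0 di0; lra.
  - rewrite -be2 -[RHS]addr0 -(mulr0 ((1 - al) * be)) -(f0 m) (mulrC (K m)).
    rewrite /I /K /e /b /moment_p /moment_pd mean_step -!meanZ -meanB -!meanZ -!meanD.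
    by apply: eq_mean => t; rewrite i0 i1; field.
  - rewrite -be2 -[RHS]subr0 -(mulr0 (al * be)) -(f0 m) (mulrC (K m)).
    rewrite /I /K /e /b /moment_p /moment_pd mean_step -!meanZ -meanB -!meanZ -!meanD -!meanB.
    by apply: eq_mean => t; rewrite j0 j1; field.
have el m : `|e m| <= (a m + b m) / 4.
  by apply: moment_pd_le; have := sqr_ge0 (al - 1 / 2); lra.
have := moments_le_large n M al0 al1 el (ltW al_gt); rewrite a0 b0.
have : 0 <= n%:R * al ^+ 3 * (1 - al) ^+ n by rewrite !mulr_ge0 ?exprn_ge0 ?subr_ge0.
have : mean n (fun t => pi n t ^+ 2) <= a n.
  by rewrite ler_mean // => t _; rewrite lerDr sqr_ge0.
have := moment_b_ge0 M n; lra.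
Qed.

Lemma difference_bound (R : realFieldType) (al be : R) pr pi dr di n :
  bit_recurrence al be pr pi dr di -> be ^+ 2 = al * (1 - al) -> 0 <= al -> al <= 1 ->
  pr 0 0 = 0 -> pi 0 0 = 0 -> dr 0 0 = 1 -> di 0 0 = 0 ->
  moment_p dr di n <= 24 * al ^+ 2 * (1 - al) ^+ n + 19 * (91 / 100) ^+ n.
Proof.
move=> H be2 al0 al1 pr0 pi0 dr0 di0.
have M := bit_moment_recurrence be2 H.
set a := moment_p pr pi in M *; set b := moment_p dr di in M *.
set e := moment_pd _ _ _ _ _ in M *.
have a0 : a 0 = 0 by rewrite /a /moment_p mean0 pr0 pi0; lra.
have b0 : b 0 = 1 by rewrite /b /moment_p mean0 dr0 di0; lra.
have e0 : e 0 = 0 by rewrite /e /moment_pd mean0 pr0 di0 pi0; lra.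
have p0 : 0 <= (91 / 100 : R) ^+ n by rewrite exprn_ge0 //; lra.
have [al_le|al_gt] := lerP al (1 / 10).
  have := b_le_small n M al0 al_le e0; rewrite a0 b0.
  have : (1 / 2 : R) ^+ n <= (91 / 100) ^+ n.
    by rewrite lerXn2r ?nnegrE //; lra.
  lra.
have el m : `|e m| <= (a m + b m) / 4.
  by apply: moment_pd_le; have := sqr_ge0 (al - 1 / 2); lra.
have := moments_le_large n M al0 al1 el (ltW al_gt); rewrite a0 b0.
have : 0 <= al ^+ 2 * (1 - al) ^+ n by rewrite mulr_ge0 ?exprn_ge0 ?subr_ge0.
have := moment_a_ge0 M n; lra.
Qed.

(** * Weighted Cauchy-Schwarz *)

Lemma cauchy_weighted (R : realFieldType) n (r u : nat -> R) :
  (forall j, 0 < r j) ->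
  (\sum_(0 <= j < n) u j) ^+ 2 <=
  (\sum_(0 <= j < n) r j) * \sum_(0 <= j < n) u j ^+ 2 / r j.
Proof.
move=> r0; case: n => [|n]; first by rewrite !big_geq // mul0r expr0n.
set P := \sum_(_ <= _ < _) u _; set Q := \sum_(_ <= _ < _) r _.
set S := \sum_(_ <= _ < _) (_ / _).
have Q0 : 0 < Q.
  rewrite /Q big_nat_recl // ltr_pwDl //.
  by apply: sumr_ge0 => j _; exact: ltW.
have : 0 <= \sum_(0 <= j < n.+1) r j * (u j / r j - P / Q) ^+ 2.
  by apply: sumr_ge0 => j _; rewrite mulr_ge0 ?sqr_ge0 // ltW.
have -> : \sum_(0 <= j < n.+1) r j * (u j / r j - P / Q) ^+ 2 =
    S - 2 * (P / Q) * P + (P / Q) ^+ 2 * Q.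
  rewrite /S {3}/P {4}/Q !mulr_sumr -sumrB -big_split /=.
  by apply: eq_bigr => j _; field; rewrite !gt_eqF.
rewrite (_ : S - _ + _ = S - P ^+ 2 / Q); last by field; rewrite gt_eqF.
by rewrite subr_ge0 ler_pdivrMr // mulrC.
Qed.

Lemma mean_sum (R : realFieldType) k n (F : nat -> nat -> R) :
  mean k (fun t => \sum_(0 <= j < n) F j t) = \sum_(0 <= j < n) mean k (F j).
Proof. by rewrite /mean exchange_big /= mulr_suml. Qed.

Lemma mean_sqr_sum_le (R : realFieldType) k n (r : nat -> R) (F : nat -> nat -> R) c :
  (forall j, 0 < r j) ->
  (forall j, (j < n)%N -> mean k (fun t => F j t ^+ 2) <= c * r j ^+ 2) ->
  mean k (fun t => (\sum_(0 <= j < n) F j t) ^+ 2) <= c * (\sum_(0 <= j < n) r j) ^+ 2.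
Proof.
move=> r0 FE.
apply: le_trans (ler_mean (fun t _ => cauchy_weighted n (fun j => F j t) r0)) _.
rewrite meanZ mean_sum expr2 mulrCA ler_wpM2l //.
  by apply: sumr_ge0 => j _; exact: ltW.
rewrite mulr_sumr !big_nat ler_sum // => j /andP[_ jn].
have -> : mean k (fun t => F j t ^+ 2 / r j) = mean k (fun t => F j t ^+ 2) / r j.
  by rewrite mulrC -meanZ; apply: eq_mean => t; rewrite mulrC.
by rewrite ler_pdivrMr // -mulrA -expr2 FE.
Qed.

(** * Sine estimates at the Fourier frequencies *)

(** Write sin y = 2 cos (y / 2) sin (y / 2) and use the mean value theorem on [0, y / 2], where cos
    >= 1/2. *)
Lemma sin_ge_id (R : realType) (y : R) : 0 <= y -> y <= pi / 2 -> y / 4 <= sin y.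
Proof.
move=> y0 ypi.
have [->|yn0] := eqVneq y 0; first by rewrite sin0 mul0r.
have y1 : 0 < y / 2 by rewrite divr_gt0 // lt_neqAle eq_sym yn0.
have ey : y = (y / 2) *+ 2 by rewrite mulr2n; lra.
have cosy : 0 <= cos y by apply: cos_ge0_pihalf; lra.
have cy : 1 / 2 <= cos (y / 2).
  have h : 1 / 2 <= cos (y / 2) ^+ 2.
    by move: cosy; rewrite {1}ey cos_mulr2n mulr2n; lra.
  have : 0 <= cos (y / 2) by apply: cos_ge0_pihalf; lra.
  by have := cos_le1 (y / 2); nra.
have [c cin E] := @MVT R (@sin R) (@cos R) 0 (y / 2) y1
  (fun x _ => @is_derive_sin R x) (continuous_subspaceT (@continuous_sin R)).
move: cin; rewrite in_itv /= => /andP[c0 cy2].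
move: E; rewrite sin0 !subr0 => E.
have cc : 1 / 2 <= cos c.
  apply: le_trans cy _; have := @ltr_cos R.
  move=> /(_ c (y / 2)); rewrite !in_itv /= => h.
  have pi0 := pi_gt0 R.
  by apply: ltW; rewrite h //; lra.
have -> : sin y = 2 * (cos (y / 2) * sin (y / 2)).
  by rewrite {1}ey sin_mulr2n mulr2n; ring.
have uv : 1 / 4 <= cos (y / 2) * cos c by nra.
by rewrite E; have := ler_wpM2r y0 uv; lra.
Qed.

Lemma sin_le_id (R : realType) (y : R) : 0 <= y -> sin y <= y.
Proof.
rewrite le_eqVlt => /orP[/eqP <-|y0]; first by rewrite sin0.
have [c cin E] := @MVT R (@sin R) (@cos R) 0 y y0
  (fun x _ => @is_derive_sin R x) (continuous_subspaceT (@continuous_sin R)).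
move: E; rewrite sin0 !subr0 => ->.
by rewrite ler_piMl ?cos_le1 // ltW.
Qed.

(** D takes values in {-k, ..., k}, so the 2 k + 1 frequencies 2 [angle] = 2 pi j / (2 k + 1)
    suffice for Fourier inversion. *)
Definition angle (R : realType) (k j : nat) : R := pi * j%:R / (2 * k + 1)%:R.

Definition sin2 (R : realType) (k j : nat) : R := sin (angle R k j) ^+ 2.

Lemma sin2_ge0 (R : realType) k j : 0 <= sin2 R k j.
Proof. exact: sqr_ge0. Qed.

Lemma sin2_le1 (R : realType) k j : sin2 R k j <= 1.
Proof. by rewrite /sin2 sin2cos2 gerBl sqr_ge0. Qed.

Lemma sin2_sym (R : realType) k j : (j <= 2 * k + 1)%N ->
  sin2 R k (2 * k + 1 - j) = sin2 R k j.
Proof.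
move=> jN; rewrite /sin2 /angle natrB //.
have d0 : (2 * k + 1)%:R != 0 :> R by rewrite pnatr_eq0 addn1.
set d := (2 * k + 1)%:R in d0 *.
have -> : pi * (d - j%:R) / d = - (pi * j%:R / d) + pi by field.
by rewrite sinDpi sinN opprK.
Qed.

Lemma angle_ge (R : realType) k j : (0 < k)%N -> 2 * j%:R / (3 * k%:R) <= angle R k j.
Proof.
move=> k0; have k0' : 0 < k%:R :> R by rewrite ltr0n.
have k1 : 1 <= k%:R :> R by rewrite ler1n.
rewrite /angle natrD natrM ler_pdivrMr ?mulr_gt0 // mulrAC ler_pdivlMr; last by lra.
have p2 := pi_ge2 R; have j0 := ler0n R j.
have h1 : 2 * k%:R + 1 <= 3 * k%:R :> R by lra.
have := ler_wpM2l (mulr_ge0 (ler0n R 2) j0) h1.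
have := ler_wpM2r (mulr_ge0 j0 (ltW k0')) p2; lra.
Qed.

Lemma angle_le_pihalf (R : realType) k j : (j <= k)%N -> angle R k j <= pi / 2.
Proof.
move=> jk; rewrite /angle natrD natrM ler_pdivrMr; last first.
  by have := ler0n R k; lra.
have : (j%:R : R) <= k%:R by rewrite ler_nat.
move=> h; have := ler_wpM2l (pi_ge0 R) h; have := pi_ge0 R; lra.
Qed.

Lemma angle_ge0 (R : realType) k j : 0 <= angle R k j.
Proof. by rewrite /angle divr_ge0 // mulr_ge0 // pi_ge0. Qed.

Lemma sin2_ge (R : realType) k j : (0 < k)%N -> (j <= k)%N ->
  j%:R ^+ 2 / (36 * k%:R ^+ 2) <= sin2 R k j.
Proof.
move=> k0 jk; have k0' : 0 < k%:R :> R by rewrite ltr0n.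
set p := 2 * j%:R / (3 * k%:R) * (1 / 4) : R.
have -> : j%:R ^+ 2 / (36 * k%:R ^+ 2) = p ^+ 2.
  by rewrite /p; field; rewrite gt_eqF.
have p0 : 0 <= p by rewrite mulr_ge0 ?divr_ge0 // mulr_ge0.
have p_le : p <= sin (angle R k j).
  apply: le_trans (sin_ge_id (angle_ge0 R k j) (angle_le_pihalf R jk)).
  by have := angle_ge R j k0; rewrite /p; lra.
by rewrite /sin2 lerXn2r ?nnegrE // (le_trans p0).
Qed.

Lemma sin2_le (R : realType) k j : (0 < k)%N -> sin2 R k j <= 4 * j%:R ^+ 2 / k%:R ^+ 2.
Proof.
move=> k0; have k0' : 0 < k%:R :> R by rewrite ltr0n.
have h1 : `|sin (angle R k j)| <= angle R k j.
  have a0 := angle_ge0 R k j; rewrite ler_norml sin_le_id // andbT.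
  have [a1|a1] := lerP (angle R k j) 1; last by have := sin_geN1 (angle R k j); lra.
  have : 0 <= sin (angle R k j) by apply: sin_ge0_pi; have := pi_ge2 R; lra.
  lra.
have h2 : angle R k j <= 2 * j%:R / k%:R.
  rewrite /angle natrD natrM ler_pdivrMr; last by lra.
  rewrite mulrAC ler_pdivlMr //.
  have p4 : pi <= 4 :> R by have := pihalf_lt2 R; lra.
  have := ler_wpM2r (mulr_ge0 (ler0n R j) (ltW k0')) p4.
  have := ler0n R j; lra.
rewrite /sin2 -real_normK ?num_real //.
have -> : 4 * j%:R ^+ 2 / k%:R ^+ 2 = (2 * j%:R / k%:R) ^+ 2 :> R.
  by field; rewrite gt_eqF.
have h3 := le_trans h1 h2.
by rewrite lerXn2r ?nnegrE // (le_trans _ h3).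
Qed.

(** * Orthogonality relations and the sign kernel *)

(** Multiplication by 2 sin f, with f = pi m / (2 k + 1), makes the sum telescope over j. The end
    terms agree by periodicity, and sin f > 0 because 0 < m < 2 k + 1. *)
Lemma sum_cos_angle (R : realType) k m : (0 < m)%N -> (m < 2 * k + 1)%N ->
  \sum_(0 <= j < 2 * k + 1) cos (2 * angle R k j * m%:R) = 0.
Proof.
move=> m0 mN; set N := (2 * k + 1)%N in mN *.
have N0' : (0 < N)%N by rewrite /N addn1.
have N0 : 0 < N%:R :> R by rewrite ltr0n.
pose f : R := pi * m%:R / N%:R.
have sf : 0 < sin f.
  apply: sin_gt0_pi; rewrite /f divr_gt0 ?mulr_gt0 ?pi_gt0 ?ltr0n //=.
  by rewrite ltr_pdivrMr // ltr_pM2l ?pi_gt0 // ltr_nat.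
have key n : 2 * sin f * (\sum_(0 <= j < n) cos (2 * angle R k j * m%:R)) =
    sin f - sin (f - 2 * n%:R * f).
  elim: n => [|n IH]; first by rewrite big_geq // mulr0 mulr0 mul0r subr0 subrr.
  rewrite big_nat_recr //= mulrDr IH.
  have -> : 2 * angle R k n * m%:R = 2 * n%:R * f.
    by rewrite /angle -/N /f; field; rewrite gt_eqF.
  have -> : f - 2 * n.+1%:R * f = - (2 * n%:R * f + f) by rewrite -(natr1 n); ring.
  rewrite sinN sinB sinD; ring.
have := key N.
have -> : f - 2 * N%:R * f = - (- f + (pi *+ 2) *+ m).
  by rewrite -[pi *+ 2 *+ m]mulr_natr -[pi *+ 2]mulr_natr /f; field; rewrite gt_eqF.
rewrite sinN (periodicn (@sinD2pi R)) sinN opprK subrr => /eqP.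
by rewrite !mulf_eq0 pnatr_eq0 (gt_eqF sf) /= => /eqP.
Qed.

Lemma sum_cos_angle_eq (R : realType) k a b :
  (a <= b + 2 * k)%N -> (b <= a + 2 * k)%N ->
  \sum_(0 <= j < 2 * k + 1) cos (2 * angle R k j * (a%:R - b%:R)) =
  (2 * k + 1)%:R * (a == b)%:R.
Proof.
wlog ba : a b / (b <= a)%N => [wl|] h1 h2.
  have [ba|ab] := leqP b a; first exact: wl.
  rewrite eq_sym -wl //; last exact: ltnW.
  by apply: eq_bigr => j _; rewrite -cosN -mulrN opprB.
have [->|ab] := eqVneq a b.
  rewrite mulr1 (eq_bigr (fun=> 1)) => [|j _]; last by rewrite subrr mulr0 cos0.
  by rewrite big_const_nat subn0 iter_addr_0.
rewrite mulr0 -natrB // sum_cos_angle //; lia.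
Qed.

(** The conjugate Dirichlet kernel, that is, the sine transform of the sign function on {-k, ...,
    k}. *)
Definition sign_kernel (R : realType) k j : R :=
  2 * \sum_(1 <= l < k.+1) sin (2 * angle R k j * l%:R).

Lemma sign_kernel_le (R : realType) k j : sign_kernel R k j ^+ 2 * sin2 R k j <= 4.
Proof.
set y := angle R k j.
have key : sign_kernel R k j * sin y = cos y - cos ((2 * k%:R + 1) * y).
  rewrite /sign_kernel -/y; elim: (k) => [|n IH].
    by rewrite big_geq // mulr0 mul0r ?mulr0 add0r mul1r subrr.
  rewrite big_nat_recr //= mulrDr mulrDl IH -(natr1 n).
  have -> : 2 * y * (n%:R + 1) = (2 * n%:R + 1) * y + y by ring.
  have -> : (2 * (n%:R + 1) + 1) * y = (2 * n%:R + 1) * y + y + y by ring.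
  set z := (2 * n%:R + 1) * y.
  rewrite [cos (z + y + y)]cosD; have -> : cos z = cos (z + y - y) by rewrite addrK.
  by rewrite cosB; ring.
rewrite /sin2 -exprMn key.
have := cos_le1 y; have := cos_geN1 y.
have := cos_le1 ((2 * k%:R + 1) * y); have := cos_geN1 ((2 * k%:R + 1) * y).
nra.
Qed.

(** Product-to-sum turns each term into a difference of cosines. Orthogonality then keeps only l = n
    - k, with sign plus, or l = k - n, with sign minus. *)
Lemma sum_sign_kernel (R : realType) k n : (n <= 2 * k)%N ->
  \sum_(0 <= j < 2 * k + 1) sign_kernel R k j * sin (2 * angle R k j * (n%:R - k%:R)) =
  (2 * k + 1)%:R * ((k < n)%:R - (n < k)%:R).
Proof.
move=> nk; rewrite /sign_kernel.
transitivity (\sum_(1 <= l < k.+1) \sum_(0 <= j < 2 * k + 1)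
   (cos (2 * angle R k j * ((l + k)%:R - n%:R)) -
    cos (2 * angle R k j * ((l + n)%:R - k%:R)))).
  rewrite exchange_big /=; apply: eq_bigr => j _.
  rewrite mulrAC mulr_sumr; apply: eq_bigr => l _; set y := angle R k j.
  have -> : 2 * y * ((l + k)%:R - n%:R) = 2 * y * l%:R - 2 * y * (n%:R - k%:R).
    by rewrite natrD; ring.
  have -> : 2 * y * ((l + n)%:R - k%:R) = 2 * y * l%:R + 2 * y * (n%:R - k%:R).
    by rewrite natrD; ring.
  by rewrite cosB cosD; ring.
transitivity (\sum_(1 <= l < k.+1)
    (2 * k + 1)%:R * ((l + k == n)%N%:R - (l + n == k)%N%:R) : R).
  rewrite !big_nat; apply: eq_bigr => l /andP[l1 lk].
  by rewrite sumrB !sum_cos_angle_eq -?mulrBr //; lia.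
rewrite -mulr_sumr sumrB; congr (_ * (_ - _)).
  have [kn|kn] := ltnP k n.
    rewrite (bigD1_seq (n - k)%N) ?iota_uniq ?mem_index_iota /=; [|by lia..].
    rewrite big1 => [|l lnk]; first by rewrite subnK ?eqxx ?addr0 // ltnW.
    by rewrite (_ : (l + k == n)%N = false) //; lia.
  rewrite big_nat big1 // => l /andP[l1 _].
  by rewrite (_ : (l + k == n)%N = false) //; lia.
have [kn|kn] := ltnP n k.
  rewrite (bigD1_seq (k - n)%N) ?iota_uniq ?mem_index_iota /=; [|by lia..].
  rewrite big1 => [|l lnk]; first by rewrite subnK ?eqxx ?addr0 // ltnW.
  by rewrite (_ : (l + n == k)%N = false) //; lia.
rewrite big_nat big1 // => l /andP[l1 _].
by rewrite (_ : (l + n == k)%N = false) //; lia.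
Qed.

(** * Characteristic functions of the carry sums *)

Lemma eq_carry_sum (R : nmodType) k t c c' (f g : nat -> R) :
  (forall n, (n <= 2 * k)%N -> f n = g n) -> carry_sum k t c c' f = carry_sum k t c c' g.
Proof.
move=> fg; rewrite /carry_sum !big_nat; apply: eq_bigr => a /andP[_ ak].
rewrite big_nat_cond [RHS]big_nat_cond; apply: eq_bigr => b /andP[/andP[_ bk] _]; apply: fg.
by rewrite mul2n -addnn leq_add // binary_weight_le.
Qed.

Lemma carry_sum_lin (R : pzRingType) k t c c' (x y : R) (f g : nat -> R) :
  carry_sum k t c c' (fun n => x * f n + y * g n) =
  x * carry_sum k t c c' f + y * carry_sum k t c c' g.
Proof.
rewrite /carry_sum !mulr_sumr -big_split; apply: eq_bigr => a _.
by rewrite !mulr_sumr -big_split.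
Qed.

(** With [trig] equal to [cos] or [sin], these are the real and imaginary parts of the transfer
    matrix of exp(2 i y D), kept apart so as to stay in [R]. *)
Definition phase_carry (R : realType) (trig : R -> R) (y : R) k t c c' : R :=
  carry_sum k t c c' (fun n => trig (2 * y * (n%:R - k%:R))).

Lemma phase_carry_shift (R : realType) (trig : R -> R) y k t c c' :
  carry_sum k t c c' (fun n => trig (2 * y * (n.+1%:R - k.+1%:R))) =
  phase_carry trig y k t c c'.
Proof.
apply: eq_carry_sum => n _; rewrite -(natr1 n) -(natr1 k).
by congr trig; ring.
Qed.

(** Low digits (0, 0) change D by -1 and (1, 1) by +1, which gives the factors exp(-2 i y) and exp(2
    i y) on the two carries. *)
Lemma cos_carry_mix (R : realType) (y : R) k t c' :
  carry_sum k t 0 c' (fun n => cos (2 * y * (n%:R - k.+1%:R))) +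
  carry_sum k t 1 c' (fun n => cos (2 * y * (n.+2%:R - k.+1%:R))) =
  cos (2 * y) * (phase_carry cos y k t 0 c' + phase_carry cos y k t 1 c')
  + sin (2 * y) * (phase_carry sin y k t 0 c' - phase_carry sin y k t 1 c').
Proof.
have -> : carry_sum k t 0 c' (fun n => cos (2 * y * (n%:R - k.+1%:R))) =
    cos (2 * y) * phase_carry cos y k t 0 c' + sin (2 * y) * phase_carry sin y k t 0 c'.
  rewrite -carry_sum_lin; apply: eq_carry_sum => n _.
  by rewrite -(natr1 k) -cosB -[RHS]cosN; congr cos; ring.
have -> : carry_sum k t 1 c' (fun n => cos (2 * y * (n.+2%:R - k.+1%:R))) =
    cos (2 * y) * phase_carry cos y k t 1 c' + - sin (2 * y) * phase_carry sin y k t 1 c'.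
  rewrite -carry_sum_lin; apply: eq_carry_sum => n _.
  by rewrite -(natr1 k) -(natr1 n.+1) -(natr1 n) mulNr -cosD; congr cos; ring.
by ring.
Qed.

Lemma sin_carry_mix (R : realType) (y : R) k t c' :
  carry_sum k t 0 c' (fun n => sin (2 * y * (n%:R - k.+1%:R))) +
  carry_sum k t 1 c' (fun n => sin (2 * y * (n.+2%:R - k.+1%:R))) =
  cos (2 * y) * (phase_carry sin y k t 0 c' + phase_carry sin y k t 1 c')
  - sin (2 * y) * (phase_carry cos y k t 0 c' - phase_carry cos y k t 1 c').
Proof.
have -> : carry_sum k t 0 c' (fun n => sin (2 * y * (n%:R - k.+1%:R))) =
    cos (2 * y) * phase_carry sin y k t 0 c' + - sin (2 * y) * phase_carry cos y k t 0 c'.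
  rewrite -carry_sum_lin; apply: eq_carry_sum => n _.
  set z := 2 * y * (n%:R - k%:R).
  rewrite (_ : 2 * y * (n%:R - k.+1%:R) = z - 2 * y) ?sinB; first by ring.
  by rewrite /z -(natr1 k); ring.
have -> : carry_sum k t 1 c' (fun n => sin (2 * y * (n.+2%:R - k.+1%:R))) =
    cos (2 * y) * phase_carry sin y k t 1 c' + sin (2 * y) * phase_carry cos y k t 1 c'.
  rewrite -carry_sum_lin; apply: eq_carry_sum => n _.
  set z := 2 * y * (n%:R - k%:R).
  rewrite (_ : 2 * y * (n.+2%:R - k.+1%:R) = z + 2 * y) ?sinD; first by ring.
  by rewrite /z -(natr1 k) -(natr1 n.+1) -(natr1 n); ring.
by ring.
Qed.

(* The weight sg of the final carry 0 selects one of the two initial vectors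
   (1, 0) and (0, 1) of the digit recurrence in the coordinates p and d. *)
Definition phase_sum (R : realType) (sg : R) (trig : R -> R) (y : R) k t c : R :=
  (phase_carry trig y k t c 1 + sg * phase_carry trig y k t c 0) / 2 ^+ k.

Definition phase_p (R : realType) (sg : R) trig y k t : R :=
  (phase_sum sg trig y k t 0 + phase_sum sg trig y k t 1) / 2.

Definition phase_d (R : realType) (sg : R) trig y k t : R :=
  (phase_sum sg trig y k t 1 - phase_sum sg trig y k t 0) / 2.

Lemma phase_bit_recurrence (R : realType) (sg y : R) :
  bit_recurrence (sin y ^+ 2) (sin y * cos y) (phase_p sg cos y) (phase_p sg sin y)
    (phase_d sg cos y) (phase_d sg sin y).
Proof.
have c2 : cos (2 * y) = 1 - 2 * sin y ^+ 2.
  by rewrite mulr_natl cos_mulr2n cos2sin2 mulr2n; ring.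
have s2 : sin (2 * y) = 2 * (sin y * cos y).
  by rewrite mulr_natl sin_mulr2n mulr2n; ring.
have nz (k : nat) : (2 : R) ^+ k != 0 by rewrite expf_neq0.
have even0 k t c' : phase_carry cos y k.+1 t.*2 0 c' =
   cos (2 * y) * (phase_carry cos y k t 0 c' + phase_carry cos y k t 1 c')
   + sin (2 * y) * (phase_carry sin y k t 0 c' - phase_carry sin y k t 1 c').
  by rewrite {1}/phase_carry carry_sum_even0 cos_carry_mix.
have even0' k t c' : phase_carry sin y k.+1 t.*2 0 c' =
   cos (2 * y) * (phase_carry sin y k t 0 c' + phase_carry sin y k t 1 c')
   - sin (2 * y) * (phase_carry cos y k t 0 c' - phase_carry cos y k t 1 c').
  by rewrite {1}/phase_carry carry_sum_even0 sin_carry_mix.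
have odd1 k t c' : phase_carry cos y k.+1 t.*2.+1 1 c' =
   cos (2 * y) * (phase_carry cos y k t 0 c' + phase_carry cos y k t 1 c')
   + sin (2 * y) * (phase_carry sin y k t 0 c' - phase_carry sin y k t 1 c').
  by rewrite {1}/phase_carry carry_sum_odd1 cos_carry_mix.
have odd1' k t c' : phase_carry sin y k.+1 t.*2.+1 1 c' =
   cos (2 * y) * (phase_carry sin y k t 0 c' + phase_carry sin y k t 1 c')
   - sin (2 * y) * (phase_carry cos y k t 0 c' - phase_carry cos y k t 1 c').
  by rewrite {1}/phase_carry carry_sum_odd1 sin_carry_mix.
have even1 trig k t c' : phase_carry trig y k.+1 t.*2 1 c' =
   2 * phase_carry trig y k t 1 c'.
  by rewrite {1}/phase_carry carry_sum_even1 phase_carry_shift mulr_natl.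
have odd0 trig k t c' : phase_carry trig y k.+1 t.*2.+1 0 c' =
   2 * phase_carry trig y k t 0 c'.
  by rewrite {1}/phase_carry carry_sum_odd0 phase_carry_shift mulr_natl.
split=> k t; rewrite /phase_p /phase_d /phase_sum;
  rewrite !(even0, even0', odd1, odd1', even1, odd0) c2 s2 (exprS 2 k);
  by field; rewrite nz.
Qed.

Lemma phase_start (R : realType) (sg y : R) :
  [/\ phase_p sg cos y 0 0 = (1 + sg) / 2, phase_p sg sin y 0 0 = 0,
      phase_d sg cos y 0 0 = (1 - sg) / 2 & phase_d sg sin y 0 0 = 0].
Proof.
rewrite /phase_p /phase_d /phase_sum /phase_carry !carry_sum_k0 /= subrr mulr0.
by rewrite cos0 sin0; split; lra.
Qed.

(** The trace in the basis p, d: the p coordinate of the image of the first basis vector plus the d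
    coordinate of the image of the second. *)
Lemma phase_cyclic_sum (R : realType) (trig : R -> R) (y : R) k t :
  cyclic_sum k t (fun n => trig (2 * y * (n%:R - k%:R))) / 2 ^+ k =
  phase_p 1 trig y k t + phase_d (- 1) trig y k t.
Proof.
rewrite /phase_p /phase_d /phase_sum /cyclic_sum -!/(phase_carry _ _ _ _ _ _).
by field; rewrite expf_neq0.
Qed.

Lemma cyclic_sum_sum (R : pzRingType) k t n (w : nat -> R) (f : nat -> nat -> R) :
  cyclic_sum k t (fun m => \sum_(0 <= j < n) w j * f j m) =
  \sum_(0 <= j < n) w j * cyclic_sum k t (f j).
Proof.
have lin c c' : carry_sum k t c c' (fun m => \sum_(0 <= j < n) w j * f j m) =
    \sum_(0 <= j < n) w j * carry_sum k t c c' (f j).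
  rewrite /carry_sum.
  transitivity (\sum_(0 <= a < 2 ^ k) \sum_(0 <= j < n) w j *
     \sum_(0 <= b < 2 ^ k | (a + b + c == t + c' * 2 ^ k)%N)
       f j (binary_weight a + binary_weight b)%N).
    apply: eq_bigr => a _; rewrite exchange_big; apply: eq_bigr => j _.
    by rewrite mulr_sumr.
  by rewrite exchange_big; apply: eq_bigr => j _; rewrite mulr_sumr.
rewrite /cyclic_sum !lin -big_split; apply: eq_bigr => j _ /=; by rewrite mulrDr.
Qed.

Lemma eq_cyclic_sum (R : nmodType) k t (f g : nat -> R) :
  (forall n, (n <= 2 * k)%N -> f n = g n) -> cyclic_sum k t f = cyclic_sum k t g.
Proof. by move=> fg; rewrite /cyclic_sum !(eq_carry_sum _ _ _ fg). Qed.

(** * Fourier expansion of the tie probability and the skewness *)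

(** P(D = 0), and below P(D > 0) - P(D < 0), with normalisation 2^k although there are 2^k + 1
    pairs. *)
Definition tie (R : realType) k t : R :=
  cyclic_sum k t (fun n => (n == k)%:R) / 2 ^+ k.

Definition skew (R : realType) k t : R :=
  cyclic_sum k t (fun n => (k < n)%:R - (n < k)%:R) / 2 ^+ k.

Lemma tieE (R : realType) k t : tie R k t = (2 * k + 1)%:R^-1 *
  \sum_(0 <= j < 2 * k + 1) (phase_p 1 cos (angle R k j) k t
                             + phase_d (- 1) cos (angle R k j) k t).
Proof.
have N0 : (2 * k + 1)%:R != 0 :> R by rewrite pnatr_eq0 addn1.
under eq_bigr => j _ do rewrite -phase_cyclic_sum.
rewrite -mulr_suml mulrA /tie; congr (_ / _); rewrite mulr_sumr -cyclic_sum_sum.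
apply: eq_cyclic_sum => n nk; rewrite -mulr_sumr sum_cos_angle_eq; [|lia|lia].
by rewrite mulKf.
Qed.

Lemma skewE (R : realType) k t : skew R k t = (2 * k + 1)%:R^-1 *
  \sum_(0 <= j < 2 * k + 1) sign_kernel R k j *
    (phase_p 1 sin (angle R k j) k t + phase_d (- 1) sin (angle R k j) k t).
Proof.
have N0 : (2 * k + 1)%:R != 0 :> R by rewrite pnatr_eq0 addn1.
set N := (2 * k + 1)%:R in N0 *.
transitivity (\sum_(0 <= j < 2 * k + 1) (N^-1 * sign_kernel R k j) *
    cyclic_sum k t (fun n => sin (2 * angle R k j * (n%:R - k%:R))) / 2 ^+ k).
  rewrite -mulr_suml /skew; congr (_ / _); rewrite -cyclic_sum_sum.
  apply: eq_cyclic_sum => n nk; under eq_bigr => j _ do rewrite -[_ * _ * sin _]mulrA.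
  by rewrite -mulr_sumr sum_sign_kernel // mulKf.
rewrite mulr_sumr; apply: eq_bigr => j _.
by rewrite -phase_cyclic_sum -!mulrA.
Qed.

Lemma cyclic_sum1 (R : comNzRingType) k t : (t < 2 ^ k)%N ->
  cyclic_sum k t (fun=> 1) = 2 ^+ k + 1 :> R.
Proof.
move=> tk; rewrite /cyclic_sum.
(* The digit recursion couples the two incoming carries, so the four counts are proved together. *)
suff [-> _ _ ->] : [/\ carry_sum k t 0 0 (fun=> 1) = t%:R + 1 :> R,
    carry_sum k t 1 0 (fun=> 1) = t%:R :> R,
    carry_sum k t 0 1 (fun=> 1) = 2 ^+ k - 1 - t%:R :> R &
    carry_sum k t 1 1 (fun=> 1) = 2 ^+ k - t%:R :> R].
  by ring.
elim: k t tk => [|k IH] t.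
  rewrite expn0 ltnS leqn0 => /eqP->; rewrite !carry_sum_k0 /= expr0.
  by rewrite !(subr0, subrr, add0r).
rewrite expnS mul2n => tk.
have /IH [h00 h10 h01 h11] : (t./2 < 2 ^ k)%N by rewrite ltn_half_double.
rewrite -(odd_double_half t); case: (odd t); rewrite ?add1n ?add0n.
  rewrite !carry_sum_odd0 !carry_sum_odd1 h00 h10 h01 h11 exprS -!natr1.
  by rewrite -muln2 natrM; split; ring.
rewrite !carry_sum_even0 !carry_sum_even1 h00 h10 h01 h11 exprS.
by rewrite -muln2 natrM; split; ring.
Qed.

(** * Second moments of order 1 / k^2 *)

Lemma phase_bounds (R : realType) k j :
  let al := sin2 R k j in let y := angle R k j in
  [/\ mean k (fun t => phase_p 1 sin y k t ^+ 2) <=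
        17 * k%:R * al ^+ 3 * (1 - al) ^+ k + 18 * (91 / 100) ^+ k,
      mean k (fun t => (phase_p 1 cos y k t - (1 - al) ^+ k) ^+ 2) <=
        5 * k%:R * al ^+ 2 * (1 - al) ^+ k + 18 * (91 / 100) ^+ k,
      mean k (fun t => phase_d (- 1) sin y k t ^+ 2) <=
        24 * al ^+ 2 * (1 - al) ^+ k + 19 * (91 / 100) ^+ k &
      mean k (fun t => phase_d (- 1) cos y k t ^+ 2) <=
        24 * al ^+ 2 * (1 - al) ^+ k + 19 * (91 / 100) ^+ k].
Proof.
move=> al y.
have al0 : 0 <= al := sin2_ge0 R k j.
have al1 : al <= 1 := sin2_le1 R k j.
have be2 : (sin y * cos y) ^+ 2 = al * (1 - al) by rewrite exprMn cos2sin2.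
have H1 := phase_bit_recurrence 1 y; have H2 := phase_bit_recurrence (- 1) y.
have [p1 q1 r1 s1] := phase_start 1 y; have [p2 q2 r2 s2] := phase_start (- 1) y.
have h : moment_p (phase_d (- 1) cos y) (phase_d (- 1) sin y) k <=
    24 * al ^+ 2 * (1 - al) ^+ k + 19 * (91 / 100) ^+ k.
  by apply: (difference_bound k H2 be2 al0 al1 _ q2 _ s2); [rewrite p2 | rewrite r2]; lra.
split.
- by apply: (imaginary_bound k H1 be2 al0 al1 _ q1 _ s1); [rewrite p1 | rewrite r1]; lra.
- by apply: (variance_bound k H1 be2 al0 al1 _ q1 _ s1); [rewrite p1 | rewrite r1]; lra.
- by apply: le_trans h; apply: ler_mean => t _; rewrite lerDr sqr_ge0.
- by apply: le_trans h; apply: ler_mean => t _; rewrite lerDl sqr_ge0.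
Qed.

Lemma mean_sqrD_le (R : realFieldType) k (F G : nat -> R) :
  mean k (fun t => (F t + G t) ^+ 2) <=
  2 * mean k (fun t => F t ^+ 2) + 2 * mean k (fun t => G t ^+ 2).
Proof.
rewrite -!meanZ -meanD; apply: ler_mean => t _.
have := sqr_ge0 (F t - G t); lra.
Qed.

Lemma inv_sum_sin2_le (R : realType) k : (0 < k)%N ->
  \sum_(0 <= j < 2 * k + 1) (1 + k%:R * sin2 R k j)^-1 <= 25 * Num.sqrt k%:R.
Proof.
move=> k0; apply: inv_sum_le => // j.
- exact: sin2_ge0.
- exact: sin2_sym.
- exact: sin2_ge.
Qed.

Lemma sin2_lower (R : realType) k j : (0 < j)%N -> (j < 2 * k + 1)%N ->
  (36 * k%:R ^+ 2)^-1 <= sin2 R k j.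
Proof.
move=> j0 jN.
have low i : (0 < i)%N -> (i <= k)%N -> (36 * k%:R ^+ 2)^-1 <= sin2 R k i.
  move=> i0 ik; apply: le_trans (sin2_ge R (leq_trans i0 ik) ik).
  rewrite -[X in X <= _]mul1r ler_wpM2r ?invr_ge0 ?mulr_ge0 ?exprn_ge0 //.
  by rewrite exprn_ege1 // ler1n.
have [jk|jk] := leqP j k; first exact: low.
by rewrite -sin2_sym ?low //; lia.
Qed.

(* The weights (1 + k al) ^-1 have sum O(sqrt k), against 2 k + 1 frequencies. *)
Lemma mean_sqr_fourier_le (R : realType) k (F : nat -> nat -> R) c :
  (0 < k)%N -> 0 <= c ->
  (forall j, (j < 2 * k + 1)%N -> mean k (fun t => F j t ^+ 2) *
     (k%:R * (1 + k%:R * sin2 R k j) ^+ 2) <= c) ->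
  mean k (fun t => ((2 * k + 1)%:R^-1 * \sum_(0 <= j < 2 * k + 1) F j t) ^+ 2) <=
  625 * c / k%:R ^+ 2.
Proof.
move=> k0 c0 Fc.
have k0' : 0 < k%:R :> R by rewrite ltr0n.
pose r j := (1 + k%:R * sin2 R k j)^-1.
have L0 j : 0 < 1 + k%:R * sin2 R k j.
  by rewrite ltr_pwDl // mulr_ge0 ?sin2_ge0.
have r0 j : 0 < r j by rewrite /r invr_gt0.
have FE j : (j < 2 * k + 1)%N -> mean k (fun t => F j t ^+ 2) <= c / k%:R * r j ^+ 2.
  move=> /Fc h; rewrite /r exprVn -mulrA -invfM ler_pdivlMr //.
  by rewrite mulr_gt0 ?exprn_gt0.
have := mean_sqr_sum_le r0 FE; set S := mean k _ => hS.
have -> : mean k (fun t => ((2 * k + 1)%:R^-1 * \sum_(0 <= j < 2 * k + 1) F j t) ^+ 2) =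
    (2 * k + 1)%:R^-1 ^+ 2 * S.
  by rewrite -meanZ; apply: eq_mean => t; rewrite exprMn.
have hr : (\sum_(0 <= j < 2 * k + 1) r j) ^+ 2 <= 625 * k%:R.
  have -> : 625 * k%:R = (25 * Num.sqrt k%:R) ^+ 2 :> R.
    by rewrite exprMn sqr_sqrtr ?ler0n //; lra.
  rewrite lerXn2r ?nnegrE ?mulr_ge0 ?sqrtr_ge0 ?inv_sum_sin2_le //.
  by apply: sumr_ge0 => j _; exact: ltW.
have hS2 : S <= 625 * c.
  apply: (le_trans hS); apply: (le_trans (ler_wpM2l (divr_ge0 c0 (ltW k0')) hr)).
  by rewrite mulrCA divfK // gt_eqF.
have hN : (2 * k + 1)%:R^-1 ^+ 2 <= (k%:R ^+ 2)^-1 :> R.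
  rewrite -exprVn lerXn2r ?nnegrE ?invr_ge0 // lef_pV2 ?posrE ?ltr0n ?ler_nat //; lia.
have S0 : 0 <= S by apply: mean_ge0 => t; exact: sqr_ge0.
rewrite mulrC; apply: ler_pM => //.
Qed.

Lemma skew_mean_le (R : realType) : exists2 C : R, 0 < C &
  forall k, (0 < k)%N -> mean k (fun t => skew R k t ^+ 2) <= C / k%:R ^+ 2.
Proof.
have [C C0 hC] := imaginary_decay R.
exists (625 * (4 * C)); first by lra.
move=> k k0.
have -> : mean k (fun t => skew R k t ^+ 2) = mean k (fun t => ((2 * k + 1)%:R^-1 *
   \sum_(0 <= j < 2 * k + 1) sign_kernel R k j *
    (phase_p 1 sin (angle R k j) k t + phase_d (- 1) sin (angle R k j) k t)) ^+ 2).
  by apply: eq_mean => t; rewrite skewE.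
apply: mean_sqr_fourier_le => //; first by rewrite mulr_ge0 // ltW.
(* At frequency 0 the kernel vanishes; this is the only frequency without the lower bound
   [sin2_lower]. *)
move=> j jN; have [->|j0] := posnP j.
  rewrite (_ : mean _ _ = 0) ?mul0r ?mulr_ge0 ?ltW //.
  rewrite -(mean_cst k (0 : R)); apply: eq_mean => t.
  rewrite /sign_kernel /angle mulr0 mul0r mulr0 big1 ?mulr0 ?mul0r ?expr0n //.
  by move=> l _; rewrite mul0r sin0.
have [hu _ hw _] := phase_bounds R k j.
have h := hC _ _ _ _ k0 (sin2_lower R j0 jN) (sin2_le1 R k j) hu hw.
set L := k%:R * _ ^+ 2 in h *.
have L0 : 0 <= L by rewrite /L mulr_ge0 ?sqr_ge0.
set x := sin2 R k j in h.
have hk : sign_kernel R k j ^+ 2 * x <= 4 := sign_kernel_le R k j.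
apply: le_trans (_ : sign_kernel R k j ^+ 2 * (C * x) <= _); last first.
  by rewrite mulrCA mulrC ler_wpM2r // ltW.
apply: le_trans (ler_wpM2l (sqr_ge0 _) h).
rewrite [X in _ <= X]mulrA; apply: ler_wpM2r => //.
have -> : mean k (fun t => (sign_kernel R k j * (phase_p 1 sin (angle R k j) k t
      + phase_d (- 1) sin (angle R k j) k t)) ^+ 2) =
    sign_kernel R k j ^+ 2 * mean k (fun t => (phase_p 1 sin (angle R k j) k t
      + phase_d (- 1) sin (angle R k j) k t) ^+ 2).
  by rewrite -meanZ; apply: eq_mean => t; rewrite exprMn.
by rewrite ler_wpM2l ?sqr_ge0 // mean_sqrD_le.
Qed.

(** The mean of the [phase_p] part of [tie]. The [phase_d] part, of mean 2^-k, is counted with the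
    fluctuations. *)
Definition tie_mean (R : realType) k : R :=
  (2 * k + 1)%:R^-1 * \sum_(0 <= j < 2 * k + 1) (1 - sin2 R k j) ^+ k.

Lemma tie_variance_le (R : realType) : exists2 C : R, 0 < C &
  forall k, (0 < k)%N ->
  mean k (fun t => (tie R k t - tie_mean R k) ^+ 2) <= C / k%:R ^+ 2.
Proof.
have [C C0 hC] := real_decay R.
exists (625 * C); first by lra.
move=> k k0.
have -> : mean k (fun t => (tie R k t - tie_mean R k) ^+ 2) =
  mean k (fun t => ((2 * k + 1)%:R^-1 * \sum_(0 <= j < 2 * k + 1)
    (phase_p 1 cos (angle R k j) k t - (1 - sin2 R k j) ^+ k
     + phase_d (- 1) cos (angle R k j) k t)) ^+ 2).
  apply: eq_mean => t; rewrite tieE /tie_mean -mulrBr -sumrB.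
  by congr ((_ * _) ^+ 2); apply: eq_bigr => j _; rewrite addrAC.
apply: mean_sqr_fourier_le => //; first exact: ltW.
move=> j jN; have [_ hu _ hw] := phase_bounds R k j.
apply: le_trans (hC _ _ _ _ k0 (sin2_ge0 R k j) (sin2_le1 R k j) hu hw).
apply: ler_wpM2r; first by rewrite mulr_ge0 ?sqr_ge0.
exact: mean_sqrD_le.
Qed.

(** * The order of the mean tie probability *)

Lemma tie_mean_le (R : realType) k : (0 < k)%N ->
  tie_mean R k <= 25 / Num.sqrt k%:R.
Proof.
move=> k0; have k0' : 0 < k%:R :> R by rewrite ltr0n.
have s0 : 0 < Num.sqrt k%:R :> R by rewrite sqrtr_gt0.
have h : \sum_(0 <= j < 2 * k + 1) (1 - sin2 R k j) ^+ k <= 25 * Num.sqrt k%:R.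
  apply: le_trans (inv_sum_sin2_le R k0); apply: ler_sum => j _.
  rewrite -[X in _ <= X]mul1r ler_pdivlMr; last first.
    by rewrite ltr_pwDl // mulr_ge0 ?sin2_ge0.
  by rewrite geometric_le_inv ?sin2_ge0 ?sin2_le1.
rewrite /tie_mean mulrC ler_pdivrMr; last by rewrite ltr0n addn1.
apply: (le_trans h); rewrite mulrAC ler_pdivlMr // -mulrA -expr2 sqr_sqrtr ?ler0n //.
by rewrite ler_wpM2l // ler_nat; lia.
Qed.

Lemma bernoulli_le (R : realFieldType) (x : R) n : 0 <= x -> x <= 1 ->
  1 - n%:R * x <= (1 - x) ^+ n.
Proof.
move=> x0 x1; elim: n => [|n IH]; first by rewrite expr0; lra.
have u0 : 0 <= 1 - x by lra.
have := ler_wpM2l u0 IH; rewrite exprS -(natr1 n).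
have := mulr_ge0 (ler0n R n) (sqr_ge0 x); lra.
Qed.

(** For j <= sqrt k / 3 one has k sin^2 <= 4/9, so by Bernoulli the term is at least 1/2. There are
    at least sqrt k / 3 such j, and 2 k + 1 <= 3 k gives 18 = 2 . 3 . 3. *)
Lemma tie_mean_ge (R : realType) k : (0 < k)%N ->
  1 / (18 * Num.sqrt k%:R) <= tie_mean R k.
Proof.
move=> k0; have k0' : 0 < k%:R :> R by rewrite ltr0n.
set s : R := Num.sqrt k%:R.
have ss : s ^+ 2 = k%:R by rewrite sqr_sqrtr // ltW.
have s1 : 1 <= s by rewrite -[X in X <= _]sqrtr1 ler_sqrt // ler1n.
have s3 : 0 <= s / 3 by lra.
have /andP[m_le m_gt] := Num.Theory.truncn_itv s3.
set m := Num.truncn (s / 3) in m_le m_gt.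
have mN : (m.+1 <= 2 * k + 1)%N.
  rewrite addn1 ltnS -(ler_nat R); apply: (le_trans m_le).
  rewrite natrM -ss; nra.
have hm : (m.+1)%:R / 2 <= \sum_(0 <= j < 2 * k + 1) (1 - sin2 R k j) ^+ k.
  rewrite (big_cat_nat (leq0n _) mN) /= ler_wpDr //.
    by apply: sumr_ge0 => j _; rewrite exprn_ge0 // subr_ge0 sin2_le1.
  have -> : (m.+1)%:R / 2 = \sum_(0 <= j < m.+1) (1 / 2) :> R.
    by rewrite big_const_nat subn0 iter_addr_0 -(mulr_natr (1 / 2)); lra.
  rewrite !big_nat ler_sum // => j /andP[_ jm].
  apply: le_trans (bernoulli_le k (sin2_ge0 R k j) (sin2_le1 R k j)).
  have := ler_wpM2l (ltW k0') (sin2_le R j k0).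
  have -> : k%:R * (4 * j%:R ^+ 2 / k%:R ^+ 2) = 4 * j%:R ^+ 2 / k%:R :> R.
    by field; rewrite gt_eqF.
  have hj : j%:R <= s / 3 by apply: le_trans m_le; rewrite ler_nat.
  have hj2 : j%:R ^+ 2 <= (s / 3) ^+ 2 by rewrite lerXn2r ?nnegrE.
  have : 4 * j%:R ^+ 2 / k%:R <= 1 / 2 :> R.
    by rewrite ler_pdivrMr // -ss; lra.
  lra.
rewrite /tie_mean [X in _ <= X]mulrC ler_pdivlMr; last by rewrite ltr0n addn1.
apply: le_trans hm; rewrite mulrAC ler_pdivrMr; last by lra.
rewrite natrD natrM -ss.
have : s / 3 * s <= m.+1%:R * s by rewrite ler_wpM2r ?ltW //; lra.
nra.
Qed.

(** * Counting the exceptional residues *)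

Lemma P_ratioE (R : realType) k t : (t < 2 ^ k - 1)%N ->
  P_ratio R t k = (1 + 2 ^- k - tie R k t - skew R k t) / 2.
Proof.
move=> tk; have k2 : (2 : R) ^+ k != 0 by rewrite expf_neq0.
have tk' : (t < 2 ^ k)%N by lia.
rewrite /P_ratio (card_S_set tk) /tie /skew.
have -> : (cyclic_sum k t (fun n => (n < k)%N : nat))%:R =
    cyclic_sum k t (fun n => (n < k)%:R) :> R.
  by rewrite /cyclic_sum /carry_sum natrD !natr_sum; congr (_ + _);
    apply: eq_bigr => a _; rewrite natr_sum.
(* Pointwise, 2 [n < k] = 1 - [n = k] - ([k < n] - [n < k]). *)
have -> : cyclic_sum k t (fun n => (n < k)%:R) = (cyclic_sum k t (fun=> 1)
   - cyclic_sum k t (fun n => (n == k)%:R)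
   - cyclic_sum k t (fun n => (k < n)%:R - (n < k)%:R)) / 2 :> R.
  have lin c : carry_sum k t c c (fun n => (n < k)%:R) = (carry_sum k t c c (fun=> 1)
     - carry_sum k t c c (fun n => (n == k)%:R)
     - carry_sum k t c c (fun n => (k < n)%:R - (n < k)%:R)) / 2 :> R.
    rewrite /carry_sum -!sumrB mulr_suml; apply: eq_bigr => a _.
    rewrite -!sumrB mulr_suml; apply: eq_bigr => b _.
    set n := (_ + _)%N.
    by case: ltngtP => _ /=; lra.
  by rewrite /cyclic_sum !lin; lra.
by rewrite cyclic_sum1 //; field.
Qed.

(** If |skew| and |tie - m| are both below m / 4, then tie + skew lies between m / 2 and 3 m / 2, so
    that 1/2 - eps < P < 1/2. An exceptional t therefore violates one of the two bounds and adds at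
    least 1 to the sum of [G]. *)
Lemma exceptional_le (R : realType) (eps : R) k m : (0 < k)%N -> 0 < m ->
  m <= eps -> 2 ^- k < m / 2 ->
  #|exceptional_set eps k|%:R <= 2 ^+ k * (16 / m ^+ 2 *
    (mean k (fun t => skew R k t ^+ 2) + mean k (fun t => (tie R k t - m) ^+ 2))).
Proof.
move=> k0 m0 m_eps k_m.
have k2 : (2 : R) ^+ k != 0 by rewrite expf_neq0.
rewrite -meanD -meanZ /mean mulrCA mulfV // mulr1.
pose G (t : nat) : R := 16 / m ^+ 2 * (skew R k t ^+ 2 + (tie R k t - m) ^+ 2).
rewrite -[X in _ <= X]/(\sum_(0 <= t < 2 ^ k) G t).
have G0 t : 0 <= G t by rewrite /G mulr_ge0 ?addr_ge0 ?divr_ge0 ?sqr_ge0.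
have le_pow : (2 ^ k - 1 <= 2 ^ k)%N by exact: leq_subr.
rewrite (big_cat_nat (leq0n _) le_pow) /= ler_wpDr ?sumr_ge0 // big_mkord.
rewrite -sum1_card natr_sum big_mkcond /=; apply: ler_sum => t _.
case: ifPn => // ; rewrite inE => /andP[_ hP].
rewrite leNgt; apply/negP => Glt.
have hm : skew R k t ^+ 2 + (tie R k t - m) ^+ 2 < m ^+ 2 / 16.
  move: Glt; rewrite /G mulrAC ltr_pdivrMr ?exprn_gt0 // mul1r => h; lra.
have hA : - (m / 4) < skew R k t < m / 4.
  by have := sqr_ge0 (tie R k t - m); move=> h; apply/andP; split; nra.
have hB : - (m / 4) < tie R k t - m < m / 4.
  by have := sqr_ge0 (skew R k t); move=> h; apply/andP; split; nra.
move: hP; rewrite P_ratioE ?ltn_ord // in_itv /= => /negP; apply.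
have p0 : 0 < 2 ^- k :> R by rewrite invr_gt0 exprn_gt0.
case/andP: hA => hA1 hA2; case/andP: hB => hB1 hB2.
by apply/andP; split; lra.
Qed.

Lemma exceptional_bound (R : realType) (eps : R) : 0 < eps ->
  exists2 C : R, 0 < C & exists K, forall k, (K <= k)%N ->
  #|exceptional_set eps k|%:R <= C * (2 ^+ k / k%:R).
Proof.
move=> eps0.
have [A A0 hA] := skew_mean_le R; have [B B0 hB] := tie_variance_le R.
exists (16 * 324 * (A + B)); first by lra.
(* 1297 = 36^2 + 1 serves 2^-k < m / 2, and the second summand serves 25 / sqrt k <= eps. *)
exists (1297 + (Num.truncn ((25 / eps) ^+ 2)).+1)%N => k kK.
have k0 : (0 < k)%N by apply: leq_trans kK; rewrite addnS.
have k0' : 0 < k%:R :> R by rewrite ltr0n.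
set s : R := Num.sqrt k%:R.
have ss : s ^+ 2 = k%:R by rewrite sqr_sqrtr // ltW.
have s1 : 1 <= s by rewrite -[X in X <= _]sqrtr1 ler_sqrt // ler1n.
set m := tie_mean R k.
have m_ge : 1 / (18 * s) <= m by exact: tie_mean_ge.
have m_le : m <= 25 / s by exact: tie_mean_le.
have m0 : 0 < m by apply: lt_le_trans m_ge; rewrite divr_gt0 // mulr_gt0 //; lra.
have ms : 1 <= 18 * s * m by move: m_ge; rewrite ler_pdivrMr; [rewrite mulrC|lra].
have m_eps : m <= eps.
  apply: (le_trans m_le); rewrite ler_pdivrMr; last by lra.
  rewrite mulrC -ler_pdivrMr //.
  have : (25 / eps) ^+ 2 <= s ^+ 2.
    have /andP[_ h] := Num.Theory.truncn_itv (sqr_ge0 (25 / eps)).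
    rewrite ss; apply: (le_trans (ltW h)); rewrite ler_nat.
    exact: leq_trans (leq_addl _ _) kK.
  have e25 : 0 <= 25 / eps by rewrite divr_ge0 // ltW.
  have s0 : 0 <= s by lra.
  by rewrite ler_pXn2r ?nnegrE.
have s0 : 0 < s by lra.
have k_m : 2 ^- k < m / 2.
  (* This yields 2^-k s^4 <= 36, and s^2 >= 1297 turns it into 2^-k s < 1/36, while m / 2 >= 1 / (36
     s). *)
  have := @geometric_le_inv_pow R (1 / 2) k 2 ltac:(lra) ltac:(lra).
  have -> : (1 - 1 / 2) ^+ k = 2 ^- k :> R by rewrite -exprVn; congr (_ ^+ _); lra.
  set q := 2 ^- k; have q0 : 0 < q by rewrite invr_gt0 exprn_gt0.
  rewrite -ss => h.
  have s4 : 1297 * s <= s ^+ 4.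
    have : 1297 <= s ^+ 2 by rewrite ss ler_nat (leq_trans (leq_addr _ _) kK).
    nra.
  have h2 : q * s ^+ 4 <= 36.
    have := mulr_ge0 (ltW q0) (sqr_ge0 s); lra.
  have h3 := ler_wpM2l (ltW q0) s4.
  have h4 : q * s < 1 / 36 by lra.
  by rewrite -(ltr_pM2r s0); lra.
apply: (le_trans (exceptional_le k0 m0 m_eps k_m)).
rewrite [X in _ <= X]mulrCA; apply: ler_wpM2l; first exact: exprn_ge0.
have := hA k k0; have := hB k k0; rewrite -/m.
set a := mean k _; set b := mean k _ => ha hb.
have hab : b + a <= (A + B) / k%:R ^+ 2 by rewrite mulrDl; lra.
(* The lower bound m >= 1 / (18 s) costs a factor 324 k, so a second moment O(1 / k^2) leaves a
   proportion O(1 / k). *)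
have hm2 : 16 / m ^+ 2 <= 16 * 324 * k%:R.
  rewrite ler_pdivrMr ?exprn_gt0 // -ss.
  have : 1 <= (18 * s * m) ^+ 2 by rewrite exprn_ege1.
  lra.
have ab0 : 0 <= b + a by rewrite addr_ge0 // mean_ge0 // => t; exact: sqr_ge0.
have c0 : 0 <= 16 / m ^+ 2 by rewrite divr_ge0 // sqr_ge0.
apply: (le_trans (ler_pM c0 ab0 hm2 hab)).
rewrite le_eqVlt; apply/orP; left; apply/eqP; field.
by rewrite gt_eqF.
Qed.

(** Together the two sets contain every residue except 0. The slack of 2 also covers k = 0, where
    [residue] is empty. *)
Lemma card_typical_exceptional (R : realType) (eps : R) k :
  (#|typical_set eps k| + #|exceptional_set eps k| <= 2 ^ k)%N /\
  (2 ^ k <= #|typical_set eps k| + #|exceptional_set eps k| + 2)%N.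
Proof.
have -> : (#|typical_set eps k| + #|exceptional_set eps k| =
    #|[set t : residue k | (0 < t)%N]%SET|)%N.
  rewrite -(cardsID (typical_set eps k) [set t : residue k | (0 < t)%N]%SET).
  congr addn; apply: eq_card => t; rewrite !inE.
    by case: (0 < t)%N.
  by case: (0 < t)%N => //=; rewrite andbT.
have Z : (#|~: [set t : residue k | (0 < t)%N]%SET| <= 1)%N.
  apply/card_le1P => t; rewrite !inE -eqn0Ngt => /eqP t0 u; rewrite !inE -eqn0Ngt.
  by apply/eqP/eqP => [u0|->//]; apply: val_inj; rewrite /= t0 u0.
have := cardsC [set t : residue k | (0 < t)%N]%SET; rewrite card_ord.
have := expn_gt0 2 k; lia.
Qed.

Theorem theorem1 (R : realType) (eps : R) (heps : 0 < eps) :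
  ((fun k : nat => #|exceptional_set eps k|%:R : R)
     =O_\oo (fun k : nat => 2 ^+ k / k%:R : R)) /\
  ((fun k : nat => #|typical_set eps k|%:R / 2 ^+ k : R) @ \oo --> (1 : R)).
Proof.
have [C C0 [K hK]] := exceptional_bound heps.
split.
  apply/eqO_exP; exists C => //; near=> k.
  rewrite ger0_norm // ger0_norm; last by rewrite divr_ge0 ?exprn_ge0.
  by apply: hK; near: k; exact: nbhs_infty_ge.
apply/cvgrPdist_le => e e0.
near=> k.
have kK : (K <= k)%N by near: k; exact: nbhs_infty_ge.
have k1 : (0 < k)%N by near: k; exact: nbhs_infty_gt.
have ke : (C + 2) / e <= k%:R by near: k; exact: nbhs_infty_ger.
have k0' : 0 < k%:R :> R by rewrite ltr0n.
have p0 : 0 < 2 ^+ k :> R by rewrite exprn_gt0.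
have [h1 h2] := card_typical_exceptional eps k.
move: h1 h2; rewrite -!(ler_nat R) !natrD natrX => h1 h2.
have h3 := hK k kK.
have kp : k%:R <= 2 ^+ k :> R by rewrite -natrX ler_nat ltnW // ltn_expl.
rewrite ger0_norm; last first.
  rewrite subr_ge0 ler_pdivrMr //.
  by have := ler0n R #|exceptional_set eps k|; lra.
(* At most C 2^k / k + 2 of the 2^k numbers are not typical, and 2 <= 2 . 2^k / k. *)
apply: le_trans (_ : (C + 2) / k%:R <= _); last by rewrite ler_pdivrMr // mulrC -ler_pdivrMr.
rewrite lerBlDr -lerBlDl ler_pdivlMr //.
have h4 : 1 <= 2 ^+ k / k%:R :> R by rewrite ler_pdivlMr // mul1r.
lra.
Unshelve. all: by end_near.
Qed.
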